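(* Let $\Gamma$ be a finite connected simple graph of valency $d$ and let $G\leqslant \mathrm{Aut}(\Gamma)$ be arc-transitive. Suppose that for every vertex $x$ of $\Gamma$ the permutation group $G_x^{\Gamma(x)}$ is semiprimitive and has a regular normal nilpotent subgroup, and suppose that $\gcd(d,6)=1$. Then for each vertex $x$ of $\Gamma$ we have $|G_x| \leqslant d!\,(d-1)!$.
   Context: For a vertex $x$ of $\Gamma$, $\Gamma(x)$ is the set of neighbours of $x$, $G_x$ is the stabiliser of $x$ in $G$, and $G_x^{\Gamma(x)}$ is the permutation group induced by $G_x$ on $\Gamma(x)$ (the local action). $G$ is arc-transitive if it acts transitively on the ordered pairs of adjacent vertices of $\Gamma$. A subgroup $N$ of a permutation group on $\Omega$ is semiregular if $N_\omega=1$ for all $\omega\in\Omega$, and regular if it is transitive and semiregular. A permutation group is semiprimitive if it is transitive and every normal subgroup of it is transitive or semiregular. *)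

(* Defs.v *)
From mathcomp Require Import all_boot all_fingroup all_solvable.

Set Implicit Arguments.
Unset Strict Implicit.
Unset Printing Implicit Defensive.

Local Open Scope group_scope.

(* A permutation group on a subset S of T is represented by a group of        *)
(* permutations of T fixing every point outside S. In the three definitions   *)
(* below, S is the set permuted (the Omega of the textbook definitions).      *)
Section PermutationGroups.

Variable T : finType.
Implicit Types (S : {set T}) (H : {group {perm T}}).

Definition perm_semiregular S H : Prop :=
  forall w, w \in S -> 'C_H[w | 'P] = 1.

Definition perm_regular S H : Prop :=
  [transitive H, on S | 'P] /\ perm_semiregular S H.

Definition semiprimitive S H : Prop :=
  [transitive H, on S | 'P] /\
  forall N : {group {perm T}}, N <| H ->
    [transitive N, on S | 'P] \/ perm_semiregular S N.

End PermutationGroups.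

Section Graphs.

Variables (T : finType) (e : rel T).
Implicit Types (x y : T) (G : {group {perm T}}).

Definition simple_graph : Prop := symmetric e /\ irreflexive e.

Definition connected_graph : Prop := forall x y, connect e x y.

Definition neighbours x : {set T} := [set y | e x y].

Definition has_valency (d : nat) : Prop := forall x, #|neighbours x| = d.

Definition graph_aut : {set {perm T}} :=
  [set g : {perm T} | [forall x, forall y, e (g x) (g y) == e x y]].

Lemma graph_autP (g : {perm T}) :
  reflect (forall x y, e (g x) (g y) = e x y) (g \in graph_aut).
Proof.
rewrite inE; apply: (iffP forallP) => [h x y | h x].
  by have /forallP/(_ y)/eqP := h x.
by apply/forallP=> y; rewrite h.
Qed.

Lemma graph_aut_group_set : group_set graph_aut.
Proof.
apply/group_setP; split=> [|g h /graph_autP gA /graph_autP hA].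
  by apply/graph_autP=> x y; rewrite !perm1.
by apply/graph_autP=> x y; rewrite !permM hA gA.
Qed.
Canonical graph_aut_group := Group graph_aut_group_set.

Definition arc_transitive G : Prop :=
  forall x y x' y', e x y -> e x' y' ->
    exists2 g : {perm T}, g \in G & g x = x' /\ g y = y'.

(* restr_perm S is a morphism defined on the setwise stabiliser of S only;    *)
(* stab_neighbours shows that no element of 'C_G[x | 'P] is lost here.        *)
Definition local_action G x : {group {perm T}} :=
  (restr_perm (neighbours x) @* 'C_G[x | 'P])%G.

Lemma stab_neighbours G x :
  G \subset graph_aut -> 'C_G[x | 'P] \subset 'N(neighbours x | 'P).
Proof.
move=> sGA; apply/subsetP=> g /setIP[Gg /astab1P/= gx].
rewrite !inE; apply/subsetP=> y; rewrite !inE /= => exy.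
have /graph_autP gA := subsetP sGA _ Gg.
by rewrite -(gA x y) [g x]gx in exy.
Qed.

End Graphs.

(* Main.v *)
Require Import Defs.
From mathcomp Require Import all_boot all_fingroup all_solvable.
From mathcomp Require Import ssralg.

(* Let x and y be adjacent vertices, X1 and Y1 the kernels of G_x and G_y on
   their neighbourhoods, B = G_xy and N = X1 :&: Y1. It suffices to prove
   N = 1: then X1 acts faithfully on the d - 1 neighbours of y distinct from x,
   while G_x / X1 embeds in Sym(d). The leading principle is that a subgroup of
   B normalised by a subgroup of G_x transitive on the neighbours of x, and by
   an element swapping x and y, fixes every vertex, and so is trivial.
   - The largest semisimple normal subgroup of N is trivial, so that N != 1
     implies 'O_p(N) != 1 for some prime p.
   - If 'O_p(B) != 1 then 'O_p(B) is not contained in X1, so by semiprimitivity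
     its commutator with the regular nilpotent normal subgroup R of the local
     action is all of R; as 'O_p(B) is a p-group, p does not divide d = #|R|.
   - Suppose that p divides #|N| but not d. Let S be a Sylow p-subgroup of B,
     T = S :&: X1, M the normaliser of T in G_x (transitive on the neighbours
     of x by the Frattini argument) and V = 'Ohm_1('Z(T)). If 'C_M(V) is
     transitive, it normalises 'Ohm_1('Z(S)) :&: N, against the leading
     principle. Otherwise each elementary abelian subgroup A of maximal rank in
     S is an offender on V, and modulo 'C_M(V) such an A centralises every
     r-group with r > 3 prime to p that it normalises. Since d is prime to 6, A
     acts trivially on a nontrivial section of R, whence A is contained in X1.
     So the Thompson subgroup of S lies in T and is normalised by M, again
     against the leading principle. *)

Set Implicit Arguments.
Unset Strict Implicit.
Unset Printing Implicit Defensive.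

Local Open Scope group_scope.

(** * Semisimple groups *)

Section Semisimple.

Variable gT : finGroupType.
Implicit Types A B C H K : {group gT}.

(* Equivalently, A is a direct product of nonabelian simple groups. *)
Definition semisimple (A : {set gT}) :=
  [forall B : {group gT}, (B <| A) ==> (B \x 'C_A(B) == A)].

Lemma semisimpleP A :
  reflect (forall B, B <| A -> B \x 'C_A(B) = A) (semisimple A).
Proof.
apply: (iffP forallP) => [ssA B nBA | ssA B]; first exact/eqP/(implyP (ssA B)).
by apply/implyP=> /ssA->.
Qed.

Lemma semisimple1 : semisimple (1%G : {group gT}).
Proof.
apply/semisimpleP=> B /normal_sub/trivGP->.
by rewrite dprod1g; apply/setIidPl; rewrite cents1.
Qed.

Lemma semisimpleJ A x : semisimple (A :^ x) = semisimple A.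
Proof.
suffices impl B y : semisimple B -> semisimple (B :^ y).
  by apply/idP/idP=> [/(impl _ x^-1)|/impl //]; rewrite /= conjsgK.
move=> /semisimpleP ssB; apply/semisimpleP=> C nCB.
have /ssB defB: (C :^ y^-1)%G <| B by rewrite -(normalJ _ _ y) /= conjsgKV.
have /= := congr1 (fun D : {set gT} => D :^ y) defB.
by rewrite dprodJ /= conjIg -centJ conjsgKV.
Qed.

(** As [A = B \x 'C_A(B)], a normal subgroup of [B] is normal in [A]; intersecting its complement in
    [A] with [B] gives the complement in [B]. *)
Lemma semisimple_normal A B : semisimple A -> B <| A -> semisimple B.
Proof.
move=> /semisimpleP ssA nBA; apply/semisimpleP=> C nCB.
have [_ defA cBC tiBC] := dprodP (ssA B nBA).
have sBA := normal_sub nBA; have sCB := normal_sub nCB.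
have nCA: C <| A.
  rewrite /normal (subset_trans sCB sBA) -defA mul_subG //.
    exact: normal_norm.
  by rewrite cents_norm // subIset // centS ?orbT.
have [_ defA' cCA tiCA] := dprodP (ssA C nCA).
rewrite dprodE ?subsetIr //; last first.
  by apply/trivgP; rewrite -tiCA setIS // setSI.
have -> /=: 'C_B(C)%G = ('C_A(C) :&: B)%G.
  by apply/val_inj; rewrite /= setIAC (setIidPr sBA).
by rewrite group_modl // defA' (setIidPr sBA).
Qed.

Lemma semisimple_center A : semisimple A -> 'Z(A) = 1.
Proof.
move=> /semisimpleP/(_ A (normal_refl A))/dprodP[_ _ _].
by rewrite setIA setIid.
Qed.

Lemma normal_TI_cent H A B : A <| H -> B <| H -> A :&: B = 1 -> A \subset 'C(B).
Proof.
move=> /andP[sAH nAH] /andP[sBH nBH] tiAB; apply/commG1P/trivgP; rewrite -tiAB.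
by rewrite commg_subI // subsetI subxx ?(subset_trans sAH) ?(subset_trans sBH).
Qed.

(** Each factor [D] is [B :&: D] times ['C_D(B :&: D)], and the latter, normal in [H] and meeting
    [B] trivially, centralises [B]. So [H = B * 'C_H(B)], with intersection inside ['Z(H) = 1]. *)
Lemma semisimple_dprod A C H :
  A \x C = H -> semisimple A -> semisimple C -> semisimple H.
Proof.
move=> dAC ssA ssC; apply/semisimpleP=> B nBH.
have [nAH nCH] := dprod_normal2 dAC; have [_ defH _ _] := dprodP dAC.
have sBH := normal_sub nBH.
have sub (D : {group gT}) : D <| H -> semisimple D -> D \subset B <*> 'C_H(B).
  move=> nDH /semisimpleP ssD; have sDH := normal_sub nDH.
  have nBD: (B :&: D)%G <| D.
    by rewrite /= setIC (normalGI sDH).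
  have [_ defD _ tiD] := dprodP (ssD _ nBD).
  have nDBH: 'C_D(B :&: D)%G <| H.
    rewrite /normal subIset ?sDH //= normsI ?norms_cent //.
      exact: normal_norm.
    by rewrite normsI ?normal_norm.
  rewrite -{1}defD mul_subG //; first by rewrite subIset ?joing_subl.
  apply: subset_trans (joing_subr _ _); rewrite subsetI (normal_sub nDBH) /=.
  apply: (normal_TI_cent nDBH nBH).
  apply/trivgP; rewrite -tiD /= subsetI subsetIl subsetI subsetIr.
  by rewrite !subIset ?subxx.
have defH': B * 'C_H(B) = H.
  rewrite -norm_joinEr ?cents_norm ?subsetIr //; apply/eqP.
  rewrite eqEsubset join_subG sBH subsetIl -{1}defH mul_subG //.
    exact: sub nAH ssA.
  exact: sub nCH ssC.
rewrite dprodE ?subsetIr //; apply/trivgP.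
have [_ ZH _ _] := dprodP (center_dprod dAC).
have <-: 'Z(H) = 1 by rewrite -ZH !semisimple_center // mulg1.
rewrite subsetI subIset ?sBH //= -{2}defH' centM subsetI.
by rewrite {1}setIA subsetIr subIset // centsC subsetIr.
Qed.

(** The complement [C] of [A :&: B] in [A] meets [B] trivially, so [A <*> B] is the direct product
    of [C] and [B]. *)
Lemma semisimple_mul H A B :
  A <| H -> B <| H -> semisimple A -> semisimple B -> semisimple (A <*> B).
Proof.
move=> nAH nBH ssA ssB.
have nIA: (A :&: B)%G <| A := normalGI (normal_sub nAH) nBH.
have [_ defA cC tiC] := dprodP (semisimpleP _ ssA _ nIA).
pose C := 'C_A(A :&: B)%G.
have nCA: C <| A.
  by rewrite /normal subsetIl /= normsI ?normG ?norms_cent ?normal_norm.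
suffices dCB: C \x B = A <*> B.
  by apply: semisimple_dprod dCB _ ssB; apply: semisimple_normal nCA.
have nCH: C <| H.
  rewrite /normal (subset_trans (normal_sub nCA) (normal_sub nAH)) /=.
  by rewrite normsI ?norms_cent ?normsI ?normal_norm.
have tiCB: C :&: B = 1.
  apply/trivgP/subsetP=> x /setIP[Cx Bx]; rewrite -tiC.
  by apply/setIP; rewrite /= inE Bx (subsetP (normal_sub nCA)).
have cCB: C \subset 'C(B) := normal_TI_cent nCH nBH tiCB.
rewrite dprodE //; last by rewrite centsC.
rewrite norm_joinEl ?(subset_trans (normal_sub nAH)) ?normal_norm // -defA.
rewrite /= [_ * 'C_A(_)]normC //.
  by rewrite -mulgA (mulSGid (subsetIr A B)).
by rewrite (subset_trans (subsetIl _ _)) ?(normal_norm nCA).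
Qed.

(** The product is the join of groups. This subgroup takes the place of the layer of the generalised
    Fitting subgroup. *)
Definition semisimple_core (H : {set gT}) : {group gT} :=
  (\prod_(A : {group gT} | (A <| H) && semisimple A) A)%G.

Lemma semisimple_core_props H :
  (semisimple_core H <| H) && semisimple (semisimple_core H).
Proof.
rewrite /semisimple_core; elim/big_ind: _ => [|A B | //].
  by rewrite normal1 semisimple1.
move=> /andP[nAH ssA] /andP[nBH ssB].
by rewrite normalY // (semisimple_mul nAH nBH).
Qed.

Lemma semisimple_core_normal H : semisimple_core H <| H.
Proof. by have /andP[] := semisimple_core_props H. Qed.

Lemma semisimple_core_semisimple H : semisimple (semisimple_core H).
Proof. by have /andP[] := semisimple_core_props H. Qed.

Lemma semisimple_core_max H A :
  A <| H -> semisimple A -> A \subset semisimple_core H.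
Proof.
by move=> nAH ssA; rewrite /semisimple_core (bigD1 A) ?nAH //= joing_subl.
Qed.

Lemma semisimple_coreJ H x :
  semisimple_core (H :^ x) = semisimple_core H :^ x :> {set gT}.
Proof.
suffices sub K y : semisimple_core K :^ y \subset semisimple_core (K :^ y).
  apply/eqP; rewrite eqEsubset sub andbT -sub_conjgV.
  by have := sub (H :^ x)%G x^-1; rewrite /= conjsgK.
apply: (@semisimple_core_max (K :^ y)%G (semisimple_core K :^ y)%G).
  by rewrite normalJ semisimple_core_normal.
by rewrite semisimpleJ semisimple_core_semisimple.
Qed.

Lemma semisimple_core_norm H : 'N(H) \subset 'N(semisimple_core H).
Proof.
by apply/subsetP=> x /normP nHx; apply/normP; rewrite -semisimple_coreJ nHx.
Qed.

(** Both kinds of core of a normal subgroup lie in those of [H], so induction reduces to simple [H],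
    which is abelian or else has trivial centre and is semisimple. *)
Lemma pcore_or_semisimple_core H :
  H :!=: 1 -> (exists p : nat, 'O_p(H) != 1) \/ semisimple_core H :!=: 1.
Proof.
have [n] := ubnP #|H|; elim: n H => // n IHn H /ltnSE leHn ntH.
have [simH | ] := boolP
  [forall B : {group gT}, (B <| H) ==> (B :==: 1) || (B :==: H)].
  have [abH | nabH] := boolP (abelian H).
    left; exists (pdiv #|H|).
    have := card_Hall (nilpotent_pcore_Hall (pdiv #|H|) (abelian_nil abH)).
    apply: contra_eq_neq => /= ->; rewrite cards1 eq_sym p_part_eq1 pi_pdiv.
    by rewrite cardG_gt1 ntH.
  right; suffices ssH: semisimple H.
    by apply: contraNneq ntH => cH1; rewrite -subG1 -cH1 semisimple_core_max.
  apply/semisimpleP=> B nBH.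
  have /orP[/eqP-> | /eqP->] := implyP (forallP simH B) nBH.
    by rewrite dprod1g; apply/setIidPl; rewrite cents1.
  have := implyP (forallP simH 'Z(H)%G) (center_normal H).
  case/orP=> /eqP ZH.
    by rewrite -/('Z(H)) ZH dprodg1.
  by rewrite -ZH center_abelian in nabH.
rewrite negb_forall => /existsP[B].
rewrite negb_imply negb_or => /and3P[nBH ntB neB].
have ltBH: #|B| < n.
  by apply: leq_trans leHn; rewrite proper_card // properEneq neB normal_sub.
have nB := normal_norm nBH.
have [[p ntp] | ntc] := IHn B ltBH ntB; [left; exists p | right].
  apply: contraNneq ntp => Op1; rewrite -subG1 -Op1 pcore_max ?pcore_pgroup //.
  by rewrite (char_normal_trans (pcore_char _ _)).
apply: contraNneq ntc => c1; rewrite -subG1 -c1.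
rewrite semisimple_core_max ?semisimple_core_semisimple //.
have sCB := normal_sub (semisimple_core_normal B).
rewrite /normal (subset_trans sCB (normal_sub nBH)) /=.
by rewrite (subset_trans nB) // semisimple_core_norm.
Qed.

End Semisimple.

(** * Coprime action *)

Section FixedPoints.

Variables (gT : finGroupType) (p : nat).
Implicit Types E U Y : {group gT}.

Lemma card_p1Elem_mem E a :
  E \in 'E_p^2(E) -> a \in E -> a != 1 ->
  #|[set Y in 'E_p^1(E) | a \in Y]| = 1%N.
Proof.
move=> E2 Ea nta; have p_pr := pnElem_prime E2.
have abelE: p.-abelem E by case/pnElemP: E2.
have oa: #[a] = p := abelem_order_p abelE Ea nta.
suffices ->: [set Y in 'E_p^1(E) | a \in Y] = [set <[a]>%G] by rewrite cards1.
apply/setP=> Y; rewrite in_set1 inE.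
apply/andP/eqP=> [[E1Y Ya] | ->].
  apply/val_inj/eqP; rewrite eq_sym eqEcard cycle_subG Ya /=.
  by rewrite (card_p1Elem E1Y) -orderE oa.
by rewrite p1ElemE // !inE cycle_subG Ea /= -orderE oa cycle_id.
Qed.

(* In additive notation, the sum of the norms over the p + 1 subgroups of
   order p of E exceeds the norm over E by p times the identity. *)
Lemma p2Elem_fixfree E U :
    E \in 'E_p^2(E) -> E \subset 'N(U) -> abelian U -> coprime #|U| p ->
    (forall Y, Y \in 'E_p^1(E) -> 'C_U(Y) = 1) -> U :=: 1.
Proof.
move=> E2 nUE abU coUp tiY; have p_pr := pnElem_prime E2.
(* [f Y] is the norm map of [Y]; its values are fixed by [Y], so it vanishes when ['C_U(Y) = 1]. *)
pose f (Y : {group gT}) (u : FiniteModule.fmod_of abU) :=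
  (\sum_(a in Y) FiniteModule.actr u a)%R.
have f0 Y u : Y \subset E -> 'C_U(Y) = 1 -> f Y u = 0%R.
  move=> sYE tiUY; apply: val_inj; apply/set1gP; rewrite -tiUY inE.
  rewrite FiniteModule.fmodP; apply/centP=> b Yb.
  have nUb: b \in 'N(U) by rewrite (subsetP nUE) ?(subsetP sYE).
  have fYb: FiniteModule.actr (f Y u) b = f Y u.
    rewrite /f FiniteModule.actr_sum [RHS](reindex_inj (mulIg b)) /=.
    apply: eq_big => [a | a Ya]; first by rewrite groupMr.
    by rewrite FiniteModule.actrM // (subsetP nUE) ?(subsetP sYE).
  apply/commgP/conjg_fixP.
  exact: etrans (esym (FiniteModule.fmvalJ _ nUb)) (congr1 val fYb).
apply/trivgP/subsetP=> x Ux; apply/set1P.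
pose u := FiniteModule.fmod abU x; suffices up0: (u *+ p = 0)%R.
  have := FiniteModule.fmvalZ p u; rewrite up0 FiniteModule.fmodK //= => xp.
  apply/eqP; rewrite -order_eq1 -dvdn1 -(eqnP coUp) dvdn_gcd order_dvdG //.
  by rewrite /= order_dvdn -xp (FiniteModule.fmval0 abU).
have [E1 E1Y]: exists Y, Y \in 'E_p^1(E).
  by apply/set0Pn; rewrite -card_gt0 (card_p1Elem_p2Elem E2).
have fE: f E u = 0%R.
  apply: f0 => //; apply/trivgP; rewrite -(tiY _ E1Y) setIS ?centS //.
  by case/pnElemP: E1Y.
have: (\sum_(Y in 'E_p^1(E)) f Y u = 0)%R.
  by apply: big1 => Y E1Y'; apply: f0 (tiY Y E1Y'); case/pnElemP: E1Y'.
(* Collect terms by [a]: the identity lies in all [p + 1] subgroups of order [p], any other element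
   in exactly one. *)
rewrite (exchange_big_dep (mem E)) /=; last first.
  by move=> Y a /pnElemP[sYE _ _] /(subsetP sYE).
rewrite (eq_bigr (fun a => FiniteModule.actr u a + u *+ (p * (a == 1%g)))%R).
  rewrite big_split /= -/(f E u) fE GRing.add0r (bigD1 1%g) //= eqxx muln1.
  rewrite big1 ?GRing.addr0 // => a /andP[_ /negPf->].
  by rewrite muln0 GRing.mulr0n.
move=> a Ea; rewrite GRing.sumr_const.
have [-> | nta] := eqVneq a 1%g.
  rewrite FiniteModule.actr1 muln1 -GRing.mulrS -(card_p1Elem_p2Elem E2).
  congr (_ *+ _)%R; apply: eq_card => Y.
  by rewrite [LHS]unfold_in /= group1 andbT.
rewrite muln0 GRing.mulr0n GRing.addr0 -[RHS]GRing.mulr1n.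
congr (_ *+ _)%R; rewrite -[RHS](card_p1Elem_mem E2 Ea nta).
by apply: eq_card => Y; rewrite [LHS]unfold_in [RHS]inE.
Qed.

End FixedPoints.

Section Coprime.

Variables (gT : finGroupType) (p : nat).
Implicit Types B E P Q U V X Y : {group gT}.

Lemma pgroup_fix_neq1 U Y :
  p.-group U -> p.-group Y -> Y \subset 'N(U) -> U :!=: 1 -> 'C_U(Y) != 1.
Proof.
move=> pU pY nUY ntU; have pYU: p.-group (Y <*> U).
  by rewrite norm_joinEl // pgroupM pY.
have nU: U <| Y <*> U by rewrite /normal joing_subr join_subG nUY normG.
apply: contraNneq (meet_center_nil (pgroup_nil pYU) nU ntU) => C1.
by rewrite -subG1 -C1 setIS //= /center subIset // centY subsetIl orbT.
Qed.

(** The P x Q lemma for abelian [V]: by coprime action [P], hence also [X], has no nontrivial fixed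
    point on [[~: V, P]], whereas a p-group has one on any nontrivial p-group. *)
Lemma abelian_PxQ V X P :
    abelian V -> p.-group V -> p.-group X -> p^'.-group P ->
    X \subset 'N(V) -> P \subset 'N(V) -> X \subset 'C(P) ->
  'C_V(X) \subset 'C(P) -> V \subset 'C(P).
Proof.
move=> abV pV pX p'P nVX nVP cXP cVXP.
have nUX: X \subset 'N([~: V, P]) by rewrite normsR // cents_norm.
have sUV: [~: V, P] \subset V by rewrite commg_subl.
have coVP: coprime #|V| #|P| by apply: pnat_coprime pV p'P.
apply/commG1P/eqP.
apply: contraTT isT => /(pgroup_fix_neq1 (pgroupS sUV pV) pX nUX).
rewrite -subG1 -(coprime_abel_cent_TI nVP coVP abV); case/negP.
by rewrite subsetI subsetIl (subset_trans _ cVXP) // setSI.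
Qed.

(** Modulo ['Phi(Q)], [[~: Q, B]] is abelian and no line of [E] has nontrivial fixed points on it,
    so [p2Elem_fixfree] makes it trivial. Thus [Q = 'Phi(Q) * 'C_Q(B)], whence [Q = 'C_Q(B)]. *)
Lemma p2Elem_cent_pgroup r E B Q :
    prime r -> r != p -> r.-group Q -> p.-abelem B -> B \subset 'N(Q) ->
    E \in 'E_p^2(B) -> (forall Y, Y \in 'E_p^1(E) -> 'C_Q(Y) \subset 'C(B)) ->
  Q \subset 'C(B).
Proof.
move=> r_pr neq_rp rQ abelB nQB E2 cYB; have [pB cBB _] := and3P abelB.
have p_pr := pnElem_prime E2; have [sEB abelE _] := pnElemP E2.
have p'Q: p^'.-group Q.
  by apply: sub_pgroup rQ => _ /eqnP->; rewrite !inE.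
have coQB: coprime #|Q| #|B| by rewrite coprime_sym (pnat_coprime pB).
pose D := 'Phi(Q)%G; have nDB: B \subset 'N(D) by rewrite gFnorm_trans.
have nDQ: Q \subset 'N(D) by rewrite gFnorm.
have sDQ: D \subset Q by apply: Phi_sub.
have nQBq: B / D \subset 'N(Q / D) by rewrite quotient_norms.
have coqq: coprime #|Q / D| #|B / D| by rewrite coprime_morph.
have abQD: abelian (Q / D) := abelem_abelian (Phi_quotient_abelem rQ).
have iso (A : {group gT}) : A \subset B -> #|A / D| = #|A|.
  move=> sAB; have nDA := subset_trans sAB nDB.
  rewrite -(card_isog (quotient_isog nDA _)) //.
  by apply: coprime_TIg; rewrite (coprimeSg sDQ) // (coprimegS sAB).
have E2q: (E / D)%G \in 'E_p^2(E / D).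
  rewrite pnElemE // !inE subxx quotient_abelem //=.
  by rewrite iso // (card_pnElem E2).
pose U := [~: Q / D, B / D]%G.
have cU: forall Y : {group coset_of D}, Y \in 'E_p^1(E / D) -> 'C_U(Y) = 1.
  move=> Y E1Y; have [sYE abelY _] := pnElemP E1Y.
  pose Y0 := (E :&: coset D @*^-1 Y)%G.
  have sY0E: Y0 \subset E := subsetIl _ _.
  have defY: Y :=: Y0 / D.
    by rewrite /= /quotient morphim_setIpre (setIidPr sYE).
  have E1Y0: Y0 \in 'E_p^1(E).
    rewrite p1ElemE // !inE sY0E /= -iso ?(subset_trans sY0E) //.
    by rewrite -defY (card_p1Elem E1Y).
  apply/trivgP; rewrite -(coprime_abel_cent_TI nQBq coqq abQD).
  rewrite subsetI subsetIl /=.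
  apply: subset_trans (setSI _ (_ : _ \subset Q / D)) _.
    by rewrite commg_subl.
  have nDY0: Y0 \subset 'N(D).
    by rewrite (subset_trans sY0E) ?(subset_trans sEB).
  rewrite defY -coprime_quotient_cent ?(pgroup_sol rQ) ?quotient_cents ?cYB //.
  by rewrite (coprimegS _ coQB) ?(subset_trans sY0E).
have U1: [~: Q / D, B / D] = 1.
  apply: (p2Elem_fixfree E2q _ _ _ cU).
  - by rewrite (subset_trans (quotientS _ sEB)) ?commg_normr.
  - by rewrite (abelianS _ abQD) // commg_subl.
  apply: coprime_dvdl (_ : _ %| #|Q / D|) _.
    by rewrite cardSg ?commg_subl.
  by rewrite coprime_sym prime_coprime // -p'natE //; apply: quotient_pgroup.
have sQDC: Q \subset D * 'C_Q(B).
  rewrite -quotientSK //= coprime_quotient_cent ?(pgroup_sol rQ) //.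
  by rewrite subsetI subxx; apply/commG1P.
have defQ: 'C_Q(B) = Q.
  rewrite -[LHS]genGid; apply: Phi_nongen; apply/eqP.
  rewrite eqEsubset join_subG sDQ subsetIl /=.
  by rewrite (subset_trans sQDC) // mul_subG ?joing_subl ?joing_subr.
by rewrite -defQ subsetIr.
Qed.

(** Induction on the index extends the hypothesis from hyperplanes to all proper [X], and so to
    [X = 1]. If the index exceeds [p], a complement of [X] contains a plane [E]; adjoining to [X] a
    line of [E] lowers the index, and [p2Elem_cent_pgroup] applies to ['C_P(X)]. *)
Lemma coprime_hyperplanes_cent r B P :
    prime r -> r != p -> r.-group P ->
    p.-abelem B -> B \subset 'N(P) -> ~~ cyclic B ->
    (forall X, X \subset B -> #|B : X| = p -> 'C_P(X) \subset 'C(B)) ->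
  P \subset 'C(B).
Proof.
move=> r_pr neq_rp rP abelB nPB ncB cXB; have [pB cBB _] := and3P abelB.
have ntB: B :!=: 1 by apply: contraNneq ncB => ->; apply: cyclic1.
have [p_pr _ _] := pgroup_pdiv pB ntB.
suffices cX n X : #|B : X| <= n -> X \proper B -> 'C_P(X) \subset 'C(B).
  have := cX _ 1%G (leqnn _); rewrite proper1G cent1T setIT.
  exact.
elim: n => // [|n IHn] in X *; first by rewrite leqNgt indexg_gt0.
move=> leXn prXB; have [oXB | neXp] := eqVneq #|B : X| p.
  by apply: cXB; rewrite ?proper_sub.
have sXB := proper_sub prXB.
have [X' dXX'] := abelem_split_dprod abelB sXB.
have [_ defB _ tiX] := dprodP dXX'.
have sX'B: X' \subset B by rewrite -defB mulG_subr.
have oX': #|X'| = #|B : X|.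
  by rewrite -divgS // -(dprod_card dXX') mulKn.
have [E E2]: exists E, E \in 'E_p^2(X').
  apply: abelem_pnElem; first exact: abelemS abelB.
  rewrite ltnNge; apply: contra neXp; rewrite -abelem_cyclic ?(abelemS sX'B) //.
  move=> cX'; rewrite -oX'; apply/eqP/(cyclic_abelem_prime _ cX').
    exact: abelemS abelB.
  by rewrite -cardG_gt1 oX' indexg_gt1 proper_subn.
have sEX': E \subset X' by case/pnElemP: E2.
apply: (@p2Elem_cent_pgroup r E) => //.
- by rewrite (pgroupS _ rP) ?subsetIl.
- by rewrite normsI ?norms_cent // cents_norm // (subset_trans cBB) ?centS.
- by rewrite (subsetP (pnElemS _ _ sX'B)).
move=> Y E1Y; rewrite -setIA -centY.
have [sYE _ _] := pnElemP E1Y; have sYX' := subset_trans sYE sEX'.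
pose K := (X <*> Y)%G; have sXK: X \subset K := joing_subl X Y.
have sKB: K \subset B by rewrite join_subG sXB (subset_trans sYX').
have oKX: #|K : X| = p.
  rewrite -divgS //= cent_joinEr ?TI_cardMg ?mulKn ?(card_p1Elem E1Y) //.
    by apply/trivgP; rewrite -tiX setIS.
  by rewrite (sub_abelian_cent2 cBB) // (subset_trans sYX').
have oBK: #|B : X| = (#|B : K| * p)%N by rewrite -oKX Lagrange_index.
apply: (IHn K); last first.
  rewrite properEneq sKB andbT; apply: contraNneq neXp => eqKB.
  by rewrite oBK eqKB indexgg mul1n.
rewrite -ltnS (leq_trans _ leXn) // oBK -[X in X < _]muln1.
by rewrite ltn_pmul2l ?indexg_gt0 ?prime_gt1.
Qed.

End Coprime.

(** * Offenders on r-groups *)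

Section Offenders.

Variables (gT : finGroupType) (p : nat).
Implicit Types A B P Q U V W X Y : {group gT}.

Lemma coprime_cent_prod A Q :
    A \subset 'N(Q) -> coprime #|Q| #|A| -> solvable Q ->
  [~: Q, A] * 'C_Q(A) = Q.
Proof.
move=> nQA coQA solQ.
have sRQ: [~: Q, A] \subset Q by rewrite commg_subl.
apply/eqP; rewrite eqEsubset mul_subG ?subsetIl //=.
rewrite -quotientSK ?commg_norml //= coprime_quotient_cent ?commg_normr //=.
by rewrite subsetI subxx quotient_cents2r.
Qed.

Lemma pgroup_cent_prime A U :
  prime p -> p.-group A -> A \subset 'N(U) -> #|U| = p -> A \subset 'C(U).
Proof.
move=> p_pr pA nUA oU; have pU: p.-group U by rewrite /pgroup oU pnat_id.
have ntU: U :!=: 1 by rewrite -cardG_gt1 oU prime_gt1.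
have pUA: p.-group (U <*> A) by rewrite norm_joinEr // pgroupM pU.
have ltR: [~: U, A] \proper U.
  apply: (nil_comm_properl (pgroup_nil pUA)); rewrite ?joing_subl //.
  by rewrite subsetI joing_subr.
rewrite centsC; apply/commG1P/eqP; rewrite trivg_card1.
have := proper_card ltR; have := cardSg (proper_sub ltR).
by case/primeP: p_pr => _ dvp; rewrite oU => /dvp/orP[//|/eqP->]; rewrite ltnn.
Qed.

(** * Offenders of prime order *)

Section PrimeOrder.

Variables (r : nat) (B P W : {group gT}).
Hypotheses (p_pr : prime p) (r_pr : prime r).
Hypotheses (r2 : r != 2) (r3 : r != 3) (neq_rp : r != p).
Hypotheses (rP : r.-group P) (oB : #|B| = p) (abelW : p.-abelem W).
Hypotheses (nPB : B \subset 'N(P)).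
Hypotheses (nWP : P \subset 'N(W)) (nWB : B \subset 'N(W)).
Hypotheses (cPW : 'C_P(W) = 1) (leW : #|W : 'C_W(B)| <= p).

(* If B does not centralise P, the group L generated by B and a P-conjugate of
   B acts on a plane U, with L :&: P acting faithfully; the Sylow p-subgroups
   of L fix distinct lines of U, so there are p + 1 of them, a power of r. *)
Lemma prime_offender_cent : B \subset 'C(P).
Proof.
have pB: p.-group B by rewrite /pgroup oB pnat_id.
have p'P: p^'.-group P.
  by apply: sub_pgroup rP => _ /eqnP->; rewrite !inE.
have coPB: coprime #|P| #|B| by rewrite coprime_sym (pnat_coprime pB).
have [// | ncPB] := boolP (B \subset 'C(P)); exfalso.
have [pW cWW _] := and3P abelW.
have [g Pg neBg]: exists2 g, g \in P & B :^ g != B.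
  apply/exists_inP; apply: contraR ncPB.
  rewrite negb_exists_in => /forall_inP nBP.
  have {}nBP: P \subset 'N(B).
    by apply/subsetP=> g /nBP; rewrite negbK => /eqP/normP.
  apply/commG1P/trivgP; rewrite -(coprime_TIg coPB) subsetI.
  by rewrite commg_subr nPB commg_subl.
pose L := (B <*> B :^ g)%G; pose P0 := (P :&: L)%G.
have sBL: B \subset L := joing_subl _ _.
have sBgL: B :^ g \subset L := joing_subr _ _.
have nPL: L \subset 'N(P).
  by rewrite join_subG nPB conj_subG // (subsetP (normG P)).
have nWL: L \subset 'N(W).
  by rewrite join_subG nWB conj_subG // (subsetP nWP).
have defL: P0 * B = L.
  rewrite /= setIC group_modr //; apply/setIidPl; rewrite -norm_joinEr //.
  rewrite join_subG joing_subr conj_subG ?joing_subr //.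
  exact: subsetP (joing_subl P B) g Pg.
have nP0L: L \subset 'N(P0) by rewrite normsI ?normG.
have p'P0: p^'.-group P0 := pgroupS (subsetIl _ _) p'P.
have oL: #|L| = (#|P0| * p)%N.
  by rewrite -defL coprime_cardMg ?oB // -oB (coprimeSg _ coPB) ?subsetIl.
have oLp: (#|L|`_p)%N = p.
  rewrite oL partnM ?cardG_gt0 ?(prime_gt0 p_pr) // part_p'nat // mul1n.
  by rewrite part_pnat_id ?pnat_id.
have pL (Y : {group gT}) : Y \in 'Syl_p(L) ->
  [/\ p.-group Y, Y \subset L, #|Y| = p & P0 * Y = L].
- rewrite inE => sylY; have [sYL pY _] := and3P sylY.
  have oY: #|Y| = p.
    by rewrite (card_Hall sylY) oLp.
  split=> //; apply/eqP; rewrite eqEcard mul_subG ?subsetIr // oL.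
  rewrite coprime_cardMg; first by rewrite oY /=.
  by rewrite coprime_sym (pnat_coprime pY).
have sylB: B \in 'Syl_p(L).
  by rewrite inE pHallE sBL oB oLp /=.
have sylBg: (B :^ g)%G \in 'Syl_p(L).
  by rewrite inE pHallE sBgL cardJg oB oLp /=.
pose U := [~: W, P0]%G.
have coWP0: coprime #|W| #|P0| := pnat_coprime pW p'P0.
have nWP0: P0 \subset 'N(W) := subset_trans (subsetIl _ _) nWP.
have defW: U * 'C_W(P0) = W by rewrite coprime_cent_prod ?(pgroup_sol pW).
have tiU: 'C_U(P0) = 1 by rewrite coprime_abel_cent_TI.
have sUW: U \subset W by rewrite commg_subl.
have cPU Q : Q \subset P0 -> Q \subset 'C(U) -> Q :=: 1.
  move=> sQP0 cQU; apply/trivgP.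
  rewrite -cPW subsetI (subset_trans sQP0) ?subsetIl //=.
  rewrite -defW centM subsetI cQU /= centsC.
  exact: subset_trans (subsetIr _ _) (centS sQP0).
(* ['C_W(B)] and ['C_W(B :^ g)] have index at most [p] in [W]; their intersection is fixed by [L],
   so lies in ['C_W(P0)], a complement of [U]. *)
have oU: #|U| <= p ^ 2.
  have tiUC: U :&: 'C_W(P0) = 1 by rewrite setIA (setIidPl sUW).
  pose C1 := 'C_W(B)%G; pose C2 := 'C_W(B :^ g)%G.
  have oC1: #|W| <= #|C1| * p.
    by rewrite -(Lagrange (subsetIl W 'C(B))) leq_pmul2l.
  have oC2: #|C2| = #|C1|.
    rewrite -(cardJg C1 g) /= conjIg -centJ.
    by rewrite (normP (subsetP nWP g Pg)).
  have sCC: C1 :&: C2 \subset 'C_W(P0).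
    rewrite subsetI subIset ?subsetIl //= centsC.
    rewrite (subset_trans (subsetIr P L)) //.
    rewrite join_subG centsC (subset_trans (subsetIl _ _)) ?subsetIr //.
    by rewrite centsC (subset_trans (subsetIr _ _)) ?subsetIr.
  have mulC: #|C1| * #|C2| <= #|W| * #|C1 :&: C2|.
    by rewrite mul_cardG leq_mul2r subset_leq_card ?orbT // mul_subG ?subsetIl.
  have oW: #|W| = (#|U| * #|'C_W(P0)|)%N by rewrite -TI_cardMg ?defW.
  rewrite -(leq_pmul2r (cardG_gt0 'C_W(P0))) -oW -(leq_pmul2l (cardG_gt0 W)).
  apply: leq_trans (leq_mul oC1 oC1) _; rewrite mulnACA mulnn.
  rewrite mulnC mulnCA leq_mul2l; apply/orP; right.
  by rewrite -mulnn -{2}oC2 (leq_trans mulC) // leq_mul2l subset_leq_card ?orbT.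
have nUL: L \subset 'N(U) by rewrite normsR.
(* Otherwise [Y] lies in ['C_L(U)], which meets [P0] trivially and so centralises it; then [Y] is
   normal in [L], hence its only Sylow p-subgroup, although [B :^ g != B]. *)
have ncYU (Y : {group gT}) : Y \in 'Syl_p(L) -> ~~ (Y \subset 'C(U)).
  move=> sylY; have [pY sYL oY defLY] := pL Y sylY.
  apply: contra neBg => cYU; pose Z := 'C_L(U)%G.
  have nZL: Z <| L by rewrite /normal subsetIl normsI ?normG ?norms_cent.
  have nP0: P0 <| L by rewrite /normal subsetIr.
  have tiZP: Z :&: P0 = 1.
    by apply: (cPU (Z :&: P0)%G); rewrite ?subsetIr // subIset // subsetIr.
  have cYP: Y \subset 'C(P0).
    apply: subset_trans (normal_TI_cent nZL nP0 tiZP).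
    by rewrite subsetI sYL.
  have nYL: Y <| L.
    by rewrite /normal sYL -defLY mul_subG ?normG // cents_norm // centsC.
  rewrite inE in sylY.
  have eqY (X : {group gT}) : X \in 'Syl_p(L) -> X :=: Y.
    move=> /pL[pX sXL oX _]; apply/eqP; rewrite eqEcard oX oY leqnn andbT.
    by rewrite (sub_normal_Hall sylY).
  by apply/eqP; have /= := eqY _ sylBg; rewrite -(eqY B sylB).
have pU: p.-group U := pgroupS sUW pW.
have oU2: #|U| = (p ^ 2)%N.
  have [pB' sB' _ _] := pL B sylB.
  have := ncYU B sylB; have [k oUk] := p_natP pU.
  move: oU; rewrite oUk leq_exp2l ?prime_gt1 // leq_eqVlt => /orP[/eqP-> // |].
  rewrite ltnS leq_eqVlt ltnS leqn0 => /orP[]/eqP k01; case/negP.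
    by apply: pgroup_cent_prime; rewrite ?(subset_trans sBL) // oUk k01.
  have U1: U :=: 1 by apply/eqP; rewrite trivg_card1 oUk k01.
  by rewrite U1 cents1.
have abelU: p.-abelem U := abelemS sUW abelW.
have U2: U \in 'E_p^2(U) by rewrite pnElemE // !inE subxx abelU oU2 /=.
have sub_oU (X : {group gT}) :
  X \subset U -> X :!=: 1 -> ~~ (U \subset X) -> #|X| = p.
- move=> sXU ntX nsUX; have: #|X| %| p ^ 2 by rewrite -oU2 cardSg.
  case/(dvdn_pfactor _ _ p_pr) => k lek ok; rewrite ok.
  case: k lek ok => [|[|[|//]]] _ ok; last 2 first.
  + by rewrite expn1.
  + case/negP: nsUX; suffices ->: X :=: U by [].
    by apply/eqP; rewrite eqEcard sXU ok oU2 /=.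
  by rewrite trivg_card1 ok in ntX.
have ntU: U :!=: 1 by rewrite trivg_card1 oU2 -(expn0 p) eqn_exp2l ?prime_gt1.
have oC (Y : {group gT}) : Y \in 'Syl_p(L) -> #|'C_U(Y)| = p.
  move=> sylY; have [pY sYL oY _] := pL Y sylY.
  apply: sub_oU; first exact: subsetIl.
    exact: pgroup_fix_neq1 pU pY (subset_trans sYL nUL) ntU.
  by rewrite subsetI subxx centsC ncYU.
(* If [Y1] and [Y2] fix the same line, so does [P1]; then [U] is the product of [[~: U, P1]] and
   ['C_U(P1)], both of order [p], and [Y1] centralises each, against [ncYU]. *)
have injC: {in 'Syl_p(L) &, injective (fun Y : {group gT} => 'C_U(Y)%G)}.
  move=> Y1 Y2 syl1 syl2 eqC12; apply/eqP; apply: contraT => neY.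
  have eqC: 'C_U(Y1) = 'C_U(Y2) := congr1 val eqC12.
  have [pY1 sY1L oY1 defL1] := pL Y1 syl1; have [pY2 sY2L oY2 _] := pL Y2 syl2.
  pose M := (Y1 <*> Y2)%G; pose P1 := (P0 :&: M)%G.
  have sML: M \subset L by rewrite join_subG sY1L.
  have defM: P1 * Y1 = M.
    by rewrite /P1 /= setIC group_modr ?joing_subl // defL1; apply/setIidPl.
  have ntP1: P1 :!=: 1.
    apply: contra neY => /eqP P11.
    rewrite -val_eqE /= eq_sym eqEcard oY1 oY2 leqnn.
    by have: Y2 \subset M := joing_subr _ _; rewrite -defM P11 mul1g => ->.
  have sP1L: P1 \subset L := subset_trans (subsetIr _ _) sML.
  have nP1: Y1 \subset 'N(P1).
    apply: normsI; first exact: subset_trans nP0L.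
    exact: subset_trans (joing_subl Y1 Y2) (normG M).
  have sP1P0: P1 \subset P0 := subsetIl _ _.
  have nUP1: P1 \subset 'N(U) := subset_trans sP1L nUL.
  have coUP1: coprime #|U| #|P1| := pnat_coprime pU (pgroupS sP1P0 p'P0).
  have tiUP1: 'C_[~: U, P1](P1) = 1.
    by rewrite coprime_abel_cent_TI ?(abelianS sUW).
  have nsUCP: ~~ (U \subset 'C(P1)).
    by apply: contra ntP1; rewrite centsC => cP1U; rewrite (cPU P1).
  have ntCP: 'C_U(P1) != 1.
    have: 'C_U(Y1) != 1 by rewrite -cardG_gt1 oC ?prime_gt1.
    apply: contraNneq => CP1; rewrite -subG1 -CP1 subsetI subsetIl /=.
    rewrite centsC (subset_trans (subsetIr P0 M)) // join_subG.
    by rewrite centsC subsetIr eqC centsC subsetIr.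
  have oCP: #|'C_U(P1)| = p.
    by apply: sub_oU; rewrite ?subsetIl // subsetI subxx.
  have oR: #|[~: U, P1]| = p.
    apply: sub_oU; rewrite ?commg_subl //.
      by apply: contra nsUCP => /eqP/commG1P.
    apply: contra ntCP => sUR; rewrite -subG1 -tiUP1 setSI //.
  case/negP: (ncYU Y1 syl1).
  have <-: [~: U, P1] * 'C_U(P1) = U.
    by rewrite coprime_cent_prod ?(pgroup_sol pU).
  have nUY1: Y1 \subset 'N(U) := subset_trans sY1L nUL.
  rewrite centM subsetI; apply/andP; split; apply: pgroup_cent_prime => //.
    by rewrite normsR.
  by rewrite normsI ?norms_cent.
have leS: #|'Syl_p(L)| <= p.+1.
  rewrite -(card_p1Elem_p2Elem U2) -(card_in_imset injC) subset_leq_card //.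
  apply/subsetP=> _ /imsetP[Y sylY ->].
  by rewrite p1ElemE // !inE subsetIl /= oC.
have gtS: 1 < #|'Syl_p(L)|.
  by apply/card_gt1P; exists B, (B :^ g)%G; rewrite eq_sym -val_eqE.
have oS: #|'Syl_p(L)| = p.+1.
  have := card_Syl_mod L p_pr; have := divn_eq #|'Syl_p(L)| p.
  move: gtS leS; set n := #|_|; set q := (n %/ p)%N => gtS leS def_n modn.
  move: def_n; rewrite modn addn1 => def_n; rewrite def_n ltnS in leS gtS *.
  have q1: q <= 1 by rewrite -(leq_pmul2r (prime_gt0 p_pr)) mul1n.
  by case: q q1 {def_n leS} gtS => [|[|//]] //; rewrite mul1n.
have rS: r.-nat p.+1.
  have: p.+1 %| #|P0| * p by rewrite -oL -oS card_Syl_dvd.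
  rewrite Gauss_dvdl ?coprimeSn // => dvS; apply: pnat_dvd dvS _.
  exact: pgroupS (subsetIl _ _) rP.
(* [p + 1] is 3 if [p = 2] and even otherwise, but it is a power of [r > 3]. *)
have [p2 | odd_p] := even_prime p_pr.
  have /pnatP := rS; rewrite p2 => /(_ isT 3 isT isT); rewrite inE => /eqP r3'.
  by move: (r3); rewrite -r3'.
have /pnatP := rS => /(_ isT 2 isT).
rewrite dvdn2 /= odd_p inE => /(_ isT)/eqP r2'.
by move: (r2); rewrite -r2'.
Qed.

End PrimeOrder.

(** * Offenders of arbitrary rank *)

Section Core.

Variables (r : nat) (P : {group gT}).
Hypotheses (r_pr : prime r) (r2 : r != 2) (r3 : r != 3) (neq_rp : r != p).
Hypothesis (rP : r.-group P).

(* By induction a hyperplane X of B satisfies #|W : 'C_W(X)| > #|X|, which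
   forces 'C_W(X) = 'C_W(B); the P x Q lemma then gives [~: 'C_P(X), B] = 1. *)
Lemma offender_trivial B W :
    p.-abelem B -> p.-abelem W ->
    B \subset 'N(P) -> P \subset 'N(W) -> B \subset 'N(W) ->
    'C_P(W) = 1 -> 'C_B(P) = 1 -> #|W : 'C_W(B)| <= #|B| ->
  B :=: 1.
Proof.
have [n] := ubnP #|B|; elim: n => // n IHn in B *.
move=> /ltnSE leBn abelB abelW nPB nWP nWB cPW cBP leW.
apply/eqP; apply: contraT => ntB; have [pB cBB _] := and3P abelB.
have [p_pr _ _] := pgroup_pdiv pB ntB; have [pW cWW _] := and3P abelW.
have p'P: p^'.-group P.
  by apply: sub_pgroup rP => _ /eqnP->; rewrite !inE.
suffices cBP': B \subset 'C(P) by rewrite -cBP (setIidPl cBP') eqxx in ntB.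
have [cycB | ncB] := boolP (cyclic B).
  have oB := cyclic_abelem_prime abelB cycB ntB.
  by apply: (@prime_offender_cent r B P W); rewrite // -[X in _ <= X]oB.
rewrite centsC; apply: (coprime_hyperplanes_cent r_pr neq_rp rP abelB nPB ncB).
move=> X sXB iXB; have oX: (#|X| * p)%N = #|B| by rewrite -iXB Lagrange.
have ntX: X :!=: 1.
  apply: contraNneq ncB => X1; rewrite prime_cyclic //.
  by rewrite -oX X1 cards1 mul1n.
have ltX: #|X| < #|W : 'C_W(X)|.
  rewrite ltnNge; apply: contraNN ntX => leX; apply/eqP; apply: (IHn X) => //.
  - rewrite (leq_trans _ leBn) // -oX -[X in X < _]muln1.
    by rewrite ltn_pmul2l ?prime_gt1.
  - exact: abelemS abelB.
  - exact: subset_trans nPB.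
  - exact: subset_trans nWB.
  by apply/trivgP; rewrite -cBP setSI.
have eqC: 'C_W(X) = 'C_W(B).
  apply/eqP; rewrite eq_sym eqEcard setIS ?centS //=.
  have [a oa] := p_natP (pgroupS sXB pB).
  have [b ob] := p_natP (pnat_dvd (dvdn_indexg W 'C_W(X)) pW).
  (* Both sides are powers of [p], so exceeding [#|X| = #|B| / p] means reaching [#|B|]. *)
  have leBX: #|B| <= #|W : 'C_W(X)|.
    move: ltX; rewrite -oX oa ob ltn_exp2l ?prime_gt1 // -expnSr.
    by rewrite leq_exp2l ?prime_gt1.
  rewrite -(leq_pmul2r (cardG_gt0 B)) (leq_trans (leq_mul (leqnn _) leBX)) //.
  rewrite (Lagrange (subsetIl W 'C(X))) -(Lagrange (subsetIl W 'C(B))).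
  by rewrite leq_mul2l leW orbT.
have nXPB: B \subset 'N('C_P(X)).
  by rewrite normsI ?norms_cent // cents_norm // (subset_trans cBB) ?centS.
pose Q := [~: 'C_P(X), B]%G.
have sQCX: Q \subset 'C_P(X) by rewrite commg_subl.
have sQP: Q \subset P := subset_trans sQCX (subsetIl _ _).
have cWQ: W \subset 'C(Q).
  apply: (@abelian_PxQ _ p W X Q) => //.
  - exact: pgroupS pB.
  - exact: pgroupS p'P.
  - exact: subset_trans nWB.
  - exact: subset_trans nWP.
  - by rewrite centsC (subset_trans sQCX) ?subsetIr.
  rewrite centsC eqC; apply: comm_norm_cent_cent => //.
    by rewrite centsC subsetIr.
  rewrite /= -eqC normsI //; first by rewrite subIset ?nWP.
  by rewrite norms_cent // cents_norm ?subsetIr.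
by apply/commG1P/trivgP; rewrite -cPW subsetI sQP centsC.
Qed.

(** Split [A] as ['C_A(P) \x B] and let [W] be the fixed points of ['C_A(P)] in [V]. By the P x Q
    lemma [P] is faithful on [W], and [best] at ['C_A(P)] is the bound that [offender_trivial] needs
    to give [B = 1]. *)
Lemma best_offender_cent A V :
    p.-abelem A -> p.-abelem V ->
    A \subset 'N(P) -> P \subset 'N(V) -> A \subset 'N(V) ->
    'C_P(V) = 1 ->
    (forall X, X \subset A -> #|X| * #|'C_V(X)| <= #|A| * #|'C_V(A)|) ->
  A \subset 'C(P).
Proof.
move=> abelA abelV nPA nVP nVA cPV best; have [pA cAA _] := and3P abelA.
have p'P: p^'.-group P.
  by apply: sub_pgroup rP => _ /eqnP->; rewrite !inE.
have [pV cVV _] := and3P abelV.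
pose A1 := 'C_A(P)%G; have sA1A: A1 \subset A := subsetIl _ _.
have [B dA1B] := abelem_split_dprod abelA sA1A.
have [_ defA _ tiB] := dprodP dA1B.
have sBA: B \subset A by rewrite -defA mulG_subr.
pose W := 'C_V(A1)%G; have sWV: W \subset V := subsetIl _ _.
suffices B1: B :=: 1 by rewrite -defA B1 mulg1 subsetIr.
have cA1P: A1 \subset 'C(P) := subsetIr _ _.
apply: (@offender_trivial B W).
- exact: abelemS abelA.
- exact: abelemS abelV.
- exact: subset_trans nPA.
- by rewrite normsI ?norms_cent // cents_norm // centsC.
- rewrite normsI ?(subset_trans sBA) ?norms_cent // cents_norm //.
  by rewrite (subset_trans cAA) ?centS.
- apply/trivgP; rewrite -cPV subsetI subsetIl centsC.
  apply: (@abelian_PxQ _ p V A1) => //.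
  + exact: pgroupS pA.
  + exact: pgroupS (subsetIl _ _) p'P.
  + exact: subset_trans nVA.
  + by rewrite subIset ?nVP.
  + by rewrite (subset_trans cA1P) ?centS ?subsetIl.
  by rewrite centsC subsetIr.
- apply/trivgP; rewrite -tiB setIC subsetI subsetIl subsetI subsetIr andbT.
  by rewrite subIset ?sBA.
have ->: 'C_W(B) = 'C_V(A) by rewrite -setIA -centM defA.
have oA: (#|A1| * #|B|)%N = #|A| by rewrite (dprod_card dA1B).
have := best A1 sA1A; rewrite -oA -mulnA leq_pmul2l //.
rewrite -(Lagrange (_ : 'C_V(A) \subset W)) ?setIS ?centS //.
by rewrite mulnC leq_pmul2r.
Qed.

End Core.

End Offenders.

(** * Offenders acting through the holomorph *)

Section Holomorph.

Variables (gT : finGroupType) (p : nat) (V : {group gT}).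
Implicit Types A H X : {group gT}.

Local Notation act := (aut_groupAction V).
Local Notation f := (conj_aut V).
Local Notation inV := (sdpair1 act).
Local Notation inA := (sdpair2 act).

(** In the semidirect product of [V] by [Aut V], the faithful action of a quotient of [X] is again
    conjugation, as [best_offender_cent] requires; fixed points are unchanged. *)
Lemma sdpair_conj_aut_cent X :
  X \subset 'N(V) -> 'C_(inV @* V)(inA @* (f @* X)) = inV @* 'C_V(X).
Proof.
move=> nVX; rewrite -morphim_setIpre -gacentEsd ?Aut_conj_aut //.
congr (_ @* _); rewrite gacentE ?Aut_conj_aut //.
apply/setP=> v; rewrite !in_setI; case Vv: (v \in V) => //=.
have actE x : x \in 'N(V) -> aut_action V v (f x) = v ^ x.
  by move=> Nx; apply: norm_conj_autE.
apply/afixP/centP=> [fixv x Xx | cXv _ /morphimP[x Nx Xx ->]].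
  have := fixv (f x) (mem_morphim _ (subsetP nVX x Xx) Xx).
  rewrite actE ?(subsetP nVX) // => vx.
  exact/commgP/conjg_fixP.
rewrite actE //; apply/conjg_fixP/commgP.
exact: cXv.
Qed.

(** Let [X] be the part of [H] commuting with [A] modulo ['C(V)]. For a prime [r > 3], the image of
    [A] centralises an invariant Sylow r-subgroup of the image of [H], so [r] does not divide the
    index. *)
Lemma offender_cent_index A H :
    p.-abelem V -> p.-abelem A ->
    A \subset 'N(V) -> H \subset 'N(V) -> A \subset 'N(H) ->
    p^'.-group (f @* H) ->
    (forall X, X \subset A -> #|X| * #|'C_V(X)| <= #|A| * #|'C_V(A)|) ->
  exists X,
    [/\ X \subset H, [~: X, A] \subset 'C(V) & (pred2 2 3).-nat #|H : X|].
Proof.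
move=> abelV abelA nVA nVH nHA p'H best; have [pA cAA _] := and3P abelA.
pose X := (H :&: f @*^-1 'C(f @* A))%G.
have nVX: X \subset 'N(V) := subset_trans (subsetIl _ _) nVH.
exists X; split; first exact: subsetIl.
  rewrite -ker_conj_aut -sub_morphim_pre ?comm_subG // morphimR // subG1.
  by apply/eqP/commG1P; rewrite morphim_setIpre subsetIr.
rewrite -(index_morphim_ker f) ?subsetIl //.
have -> : #|'ker_H f : X| = 1%N.
  apply/eqP; rewrite indexg_eq1 subsetI subsetIl subIset //.
  by rewrite ker_sub_pre orbT.
rewrite muln1 /= morphim_setIpre.
apply/pnatP=> // r r_pr dvr; apply: contraLR dvr.
rewrite !inE negb_or => /andP[r2 r3].
have nfHA: f @* A \subset 'N(f @* H) by rewrite morphim_norms.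
have pfA: p.-group (f @* A) by rewrite morphim_pgroup.
have cofHA: coprime #|f @* H| #|f @* A|.
  by rewrite coprime_sym (pnat_coprime pfA).
have [P sylP nPA] := sol_coprime_Sylow_exists r (pgroup_sol pfA) nfHA cofHA.
have [sPH rP _] := and3P sylP.
have [P1 | ntP] := eqVneq P 1%G.
  rewrite P1 pHallE sub1G cards1 /= eq_sym p_part_eq1 in sylP.
  apply: contra sylP => dvr; rewrite mem_primes r_pr cardG_gt0.
  exact: dvdn_trans dvr (dvdn_indexg _ _).
have neq_rp: r != p.
  apply: contraNneq ntP => eq_rp; rewrite -val_eqE trivg_card1 /=.
  apply/eqP; apply: (@pnat_1 p); first by rewrite -eq_rp.
  exact: pgroupS p'H.
have sAutP := subset_trans sPH (Aut_conj_aut V H).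
suffices cAP: f @* A \subset 'C(P).
  have sPC: P \subset 'C_(f @* H)(f @* A) by rewrite subsetI sPH centsC.
  rewrite -(p'natE _ r_pr); apply: pnat_dvd (indexgS _ sPC) _.
  by case/and3P: sylP.
have abelfA: p.-abelem (f @* A) := morphim_abelem f abelA.
have injA := injm_sdpair2 act; have injV := injm_sdpair1 act.
have sAA: f @* A \subset Aut V := Aut_conj_aut V A.
(* The inequality [best] passes to the image of [A]: both sides are divided by the order of the
   kernel. *)
have cardf (Y : {group gT}) : Y \subset A -> 'ker_A f \subset Y ->
    #|Y| = (#|f @* Y| * #|'ker_A f|)%N.
  move=> sYA skY; rewrite card_morphim (setIidPr (subset_trans sYA nVA)) mulnC.
  have kY: 'ker_Y f = 'ker_A f.
    by apply/eqP; rewrite eqEsubset setSI // subsetI skY subsetIr.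
  by rewrite -indexgI /= -kY Lagrange ?subsetIl.
rewrite -(injm_cents injA) //; set gA := inA @* _; set gP := inA @* P.
apply: (@best_offender_cent _ p r [group of gP] r_pr r2 r3 neq_rp _
   [group of gA] [group of inV @* V]).
- exact: morphim_pgroup.
- exact: morphim_abelem.
- exact: morphim_abelem.
- exact: morphim_norms.
- exact: subset_trans (morphimS _ sAutP) (im_sdpair_norm _).
- exact: subset_trans (morphimS _ sAA) (im_sdpair_norm _).
- rewrite -morphim_setIpre -astabEsd //=.
  suffices ->: P :&: 'C(V | aut_action V) = 1 by rewrite morphim1.
  apply/trivgP/subsetP=> a /setIP[Pa cVa]; apply/set1P.
  apply: (eq_Aut (subsetP sAutP a Pa) (group1 _)) => v Vv.
  rewrite perm1; exact: (astab_act cVa Vv).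
move=> X0 sX0; pose X1 := (A :&: f @*^-1 (inA @*^-1 X0))%G.
have sX1A: X1 \subset A := subsetIl _ _.
have defX0: X0 :=: inA @* (f @* X1).
  rewrite /= !morphim_setIpre; apply/esym/setIidPr; exact: sX0.
rewrite defX0 !sdpair_conj_aut_cent ?(subset_trans sX1A) //.
rewrite !(card_injm injV) ?subsetIl // !(card_injm injA) ?Aut_conj_aut //.
rewrite -(leq_pmul2r (cardG_gt0 ('ker_A f))) mulnAC -cardf //; last first.
  by rewrite subsetI subsetIl subIset // ker_sub_pre orbT.
by rewrite mulnAC -cardf ?subsetIl // best.
Qed.

End Holomorph.

(** * The Thompson subgroup *)

Section ThompsonSubgroup.

Variables (gT : finGroupType) (p : nat).
Implicit Types A S T V Y : {group gT}.

(** [Y <*> 'C_V(Y)] is elementary abelian, so no larger than [A], and [Y :&: 'C_V(Y)] lies in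
    ['C_V(A)] since [A] is abelian. *)
Lemma max_pnElem_offender S V A Y :
    prime p -> p.-group S -> V \subset S -> p.-abelem V ->
    A \in 'E_p^('r_p(S))(S) -> Y \subset A ->
  #|Y| * #|'C_V(Y)| <= #|A| * #|'C_V(A)|.
Proof.
move=> p_pr pS sVS abelV EA sYA; have [sAS abelA dimA] := pnElemP EA.
have [pA cAA _] := and3P abelA.
have cprYC: Y \* 'C_V(Y) = Y <*> 'C_V(Y).
  by rewrite cprodE ?cent_joinEr ?subsetIr // centsC subsetIr.
have EYC: (Y <*> 'C_V(Y))%G \in 'E_p(S).
  rewrite inE join_subG (subset_trans sYA) //= subIset ?sVS //=.
  rewrite (cprod_abelem p cprYC) (abelemS sYA) //.
  by rewrite (abelemS (subsetIl _ _)).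
have leYC: #|Y <*> 'C_V(Y)| <= #|A|.
  have pYC: p.-group (Y <*> 'C_V(Y)) by case/setIdP: EYC => _ /abelem_pgroup.
  rewrite (card_pgroup pYC) (card_pgroup pA) leq_pexp2l ?prime_gt0 // dimA.
  exact: logn_le_p_rank.
rewrite mul_cardG leq_mul //.
  by rewrite -cent_joinEr ?subsetIr.
rewrite subset_leq_card // subsetI subIset ?subsetIl ?orbT //=.
by rewrite subIset // (subset_trans sYA).
Qed.

(** The elementary abelian version of the Thompson subgroup, often written J_e(S). *)
Definition thompson_subgroup (S : {set gT}) :=
  <<\bigcup_(A in 'E_p^('r_p(S))(S)) A>>.

Canonical thompson_group (S : {set gT}) :=
  Eval hnf in [group of thompson_subgroup S].

Lemma thompson_subgroup_sub S : thompson_subgroup S \subset S.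
Proof. by rewrite gen_subG; apply/bigcupsP=> A /pnElemP[]. Qed.

Lemma thompson_subgroup_neq1 S :
  prime p -> p %| #|S| -> thompson_subgroup S != 1.
Proof.
move=> p_pr dvp; have [A EA] := p_rank_witness p S.
have ntA: A :!=: 1.
  apply: nt_pnElem EA _; rewrite p_rank_gt0 mem_primes p_pr cardG_gt0 //.
by apply: contraNneq ntA => J1; rewrite -subG1 -J1 sub_gen // (bigcup_sup A).
Qed.

(** An element normalising [T] permutes the generators even if it does not normalise [S]: their
    conjugates stay in [T], hence in [S]. *)
Lemma thompson_subgroup_norm_sub S T :
    {in 'E_p^('r_p(S))(S), forall A, A \subset T} -> T \subset S ->
  'N(T) \subset 'N(thompson_subgroup S).
Proof.
move=> sET sTS; rewrite norms_gen //; apply/subsetP=> x nTx; rewrite inE.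
apply/subsetP=> y; rewrite mem_conjg => /bigcupP[A EA Ay].
apply/bigcupP; exists (A :^ x)%G; last by rewrite mem_conjg.
have [_ abelA dimA] := pnElemP EA.
apply/pnElemP; rewrite abelemJ cardJg; split=> //.
by rewrite (subset_trans _ sTS) // -(normP nTx) conjSg sET.
Qed.

Lemma thompson_subgroup_norm S : 'N(S) \subset 'N(thompson_subgroup S).
Proof. by apply: thompson_subgroup_norm_sub => // A /pnElemP[]. Qed.

End ThompsonSubgroup.

(** * Vertex-stabiliser amalgams *)

(* X, B and X1 stand for G_x, G_xy and the kernel of G_x on the neighbours of
   x, K is the preimage in G_x of the regular nilpotent normal subgroup of the
   local action, and t swaps x and y. For a subgroup U of X, B * U = X means
   that U is transitive on the neighbours of x; for a normal subgroup W of X,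
   W :&: B \subset X1 means that W induces a semiregular group there. *)
Section Amalgam.

Variables (gT : finGroupType) (X B X1 K : {group gT}) (t : gT).
Implicit Types A C D H M N P R S U W Y Z : {group gT}.

Hypotheses (sBX : B \subset X) (nX1X : X1 <| X) (sX1B : X1 \subset B).
Hypotheses (nBt : t \in 'N(B)) (Bt2 : t * t \in B).
Hypothesis faithful : forall Y U s, Y \subset B -> U \subset X -> B * U = X ->
  U \subset 'N(Y) -> s \in B :* t -> s \in 'N(Y) -> Y :=: 1.
Hypothesis semiprim : forall W, W <| X -> B * W = X \/ W :&: B \subset X1.
Hypotheses (nKX : K <| X) (sX1K : X1 \subset K) (tiKB : K :&: B = X1).
Hypotheses (trK : B * K = X) (nilK : nilpotent (K / X1)).

Let N := (X1 :&: X1 :^ t)%G.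

Let nX1 : X \subset 'N(X1) := normal_norm nX1X.
Let nX1B : B \subset 'N(X1) := subset_trans sBX nX1.
Let sKX : K \subset X := normal_sub nKX.
Let defBt : B :^ t = B := normP nBt.

(** As [B] normalises [X1] and [X1 :^ t] and contains [t * t], conjugation by [s] interchanges the
    two. *)
Lemma swap_norm s : s \in B :* t -> s \in 'N(N).
Proof.
case/rcosetP=> b Bb ->; have X1b := normP (subsetP nX1B b Bb).
have nX1tB: B \subset 'N(X1 :^ t) by rewrite -defBt normJ conjSg.
have X1tb := normP (subsetP nX1tB b Bb).
apply/normP; rewrite /= conjIg !conjsgM X1b X1tb -conjsgM.
by rewrite (normP (subsetP nX1B _ Bt2)) setIC.
Qed.

Lemma edge_kernel_normal : N <| B.
Proof.
rewrite /normal subIset ?sX1B //= normsI //.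
by rewrite -defBt normJ conjSg.
Qed.

Lemma edge_kernel_normal1 : N <| X1.
Proof. exact: normalS (subsetIl _ _) sX1B edge_kernel_normal. Qed.

Lemma swap_self : t \in B :* t.
Proof. exact: rcoset_refl. Qed.

(** [Y <*> D] is normal in [X = B * K] and, containing [Y], is not semiregular, so it is transitive.
    As [Y] lies in [B], already [D] is transitive, and regularity of [K] gives [D = K]. *)
Lemma comm_regular_full Y D :
    Y \subset B -> B \subset 'N(Y) -> ~~ (Y \subset X1) ->
    D <| X -> X1 \subset D -> D \subset K -> [~: K, Y] \subset D ->
  D :=: K.
Proof.
move=> sYB nYB nsYX1 nDX sX1D sDK sRD.
have nDX' := normal_norm nDX; have nDK := subset_trans sKX nDX'.
have nsYDX : (Y <*> D)%G <| X.
  rewrite /normal join_subG (subset_trans sYB) ?(subset_trans sDK) //= -trK.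
  rewrite mul_subG //; first by rewrite normsY // (subset_trans sBX).
  have nDY: Y \subset 'N(D) by rewrite (subset_trans sYB) ?(subset_trans sBX).
  rewrite -commg_subr commGC /= norm_joinEl // commMG.
    rewrite (subset_trans _ (mulG_subr Y D)) //.
    by rewrite mul_subG ?commg_subl // commGC.
  exact: subset_trans sDK (commg_normr _ _).
have [trYD | tiYD] := semiprim nsYDX; last first.
  case/negP: nsYX1; apply: subset_trans tiYD.
  by rewrite subsetI joing_subl sYB.
have nDY: Y \subset 'N(D) by rewrite (subset_trans sYB) ?(subset_trans sBX).
have trD: B * D = X by rewrite -trYD /= norm_joinEl // mulgA (mulGSid sYB).
apply/eqP; rewrite eqEsubset sDK /= -(mulSGid sX1D) -tiKB group_modr //.
by rewrite subsetI trD sKX subxx.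
Qed.

(** The complement [D] of [My :&: N] in [My] centralises [M]. If ['C_X(M)] is transitive, it
    centralises the core of [N], a subgroup of [M], and [faithful] applies. Otherwise [D] lies in
    [X1], so in [N], and is trivial; then [M] equals the core of [N], which [X] and [t] both
    normalise. *)
Lemma semisimple_core_edge_kernel : semisimple_core N :=: 1.
Proof.
pose M := semisimple_core X1; pose My := (M :^ t)%G.
have nMX: X \subset 'N(M) := subset_trans nX1 (semisimple_core_norm X1).
have sMX1: M \subset X1 := normal_sub (semisimple_core_normal X1).
have sMyX1: My \subset X1 :^ t by rewrite conjSg.
have sMyB: My \subset B by rewrite (subset_trans sMyX1) // -defBt conjSg.
have ssMy: semisimple My by rewrite semisimpleJ semisimple_core_semisimple.
have nMyB: My <| B.
  by rewrite /normal sMyB -defBt normJ conjSg (subset_trans sBX).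
have nMB: M <| B by rewrite /normal (subset_trans sMX1) ?(subset_trans sBX).
have nNX1: semisimple_core N <| X1.
  have sCN := normal_sub (semisimple_core_normal N).
  rewrite /normal (subset_trans sCN) ?subsetIl //.
  apply: subset_trans (semisimple_core_norm N).
  exact: normal_norm edge_kernel_normal1.
have sNB: N \subset B := normal_sub edge_kernel_normal.
have sCNB: semisimple_core N \subset B.
  exact: subset_trans (normal_sub (semisimple_core_normal N)) sNB.
have sCNM: semisimple_core N \subset M.
  by rewrite semisimple_core_max ?semisimple_core_semisimple.
have nCNt: t \in 'N(semisimple_core N).
  exact: subsetP (semisimple_core_norm N) t (swap_norm swap_self).
pose I := (My :&: N)%G; pose D := 'C_My(I)%G.
have nIMy: I <| My := normalGI sMyB edge_kernel_normal.
have [_ defMy _ tiID] := dprodP (semisimpleP _ ssMy _ nIMy).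
have sDMy: D \subset My := subsetIl _ _.
have tiDN: D :&: N = 1.
  apply/trivgP; rewrite -tiID subsetI subsetIl andbT.
  by rewrite setSI.
have nIB: B \subset 'N(I).
  exact: normsI (normal_norm nMyB) (normal_norm edge_kernel_normal).
have nDB: D <| B.
  rewrite /normal (subset_trans sDMy sMyB) normsI ?norms_cent //.
  exact: normal_norm nMyB.
have cDM: D \subset 'C(M).
  apply: (normal_TI_cent nDB nMB); apply/trivgP; rewrite -tiDN.
  rewrite subsetI subsetIl subsetI (subset_trans (subsetIr _ _)) //=.
  by rewrite (subset_trans (subsetIl _ _)) // (subset_trans sDMy).
pose C := 'C_X(M)%G.
have nCX: C <| X by rewrite /normal subsetIl normsI ?normG ?norms_cent.
have [trC | tiC] := semiprim nCX.
  apply: (faithful sCNB (subsetIl _ _) trC _ swap_self nCNt).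
  by rewrite cents_norm // centsC (subset_trans sCNM) // centsC subsetIr.
have sDX1: D \subset X1.
  rewrite (subset_trans _ tiC) // subsetI (normal_sub nDB) andbT subsetI cDM.
  by rewrite (subset_trans (normal_sub nDB)).
have D1: D :=: 1.
  apply/trivgP; rewrite -tiDN subsetI subxx subsetI sDX1.
  exact: subset_trans sMyX1.
have sMyN: My \subset N by rewrite -defMy D1 mulg1 subsetIr.
have eqMy: My :=: semisimple_core N.
  apply/eqP; rewrite eqEsubset semisimple_core_max //=.
    by rewrite -(normP nCNt) conjSg.
  exact: normalS sMyN sNB nMyB.
have eqM: M :=: semisimple_core N.
  by apply: (conjsg_inj (x := t)); rewrite (normP nCNt) -eqMy.
apply: (faithful sCNB (subxx X) (mulSGid sBX) _ swap_self nCNt).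
by rewrite -eqM.
Qed.

Lemma index_arc_stab : #|X : B| = #|K : X1|.
Proof.
apply/eqP; rewrite -(eqn_pmul2r (cardG_gt0 B)) mulnC Lagrange //.
have nKB := subset_trans sBX (normal_norm nKX).
by rewrite -tiKB indexgI LagrangeMr -(normC nKB) trK.
Qed.

Lemma pcore_ndvd_index (p : nat) : 'O_p(B) != 1 -> ~~ (p %| #|X : B|).
Proof.
move=> ntR; pose R := 'O_p(B)%G; have nRB: B \subset 'N(R) := gFnorm _ _.
have sRB: R \subset B := pcore_sub _ _.
(* Inside [X1], [R] would be ['O_p(X1)], normalised by [X] as well as by [t]. *)
have nsRX1: ~~ (R \subset X1).
  apply: contra ntR => sRX1; apply/eqP.
  have defR: R :=: 'O_p(X1).
    apply/eqP; rewrite eqEsubset !pcore_max ?pcore_pgroup //.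
      by rewrite (char_normal_trans (pcore_char _ _)) // /normal sX1B.
    by rewrite /normal sRX1 (subset_trans sX1B).
  apply: (faithful sRB (subxx X) (mulSGid sBX) _ swap_self).
    by rewrite defR gFnorm_trans.
  by apply/normP; rewrite -pcoreJ defBt.
(* [K / D0] is the largest p-quotient of [K / X1]. It is covered by [[~: K, R]] with [R] a p-group,
   so it is trivial. *)
pose Q := 'O_p^'(K / X1)%G; pose D0 := (coset X1 @*^-1 Q)%G.
have nX1K: K \subset 'N(X1) := subset_trans sKX nX1.
have sX1D0: X1 \subset D0 := sub_cosetpre _.
have sD0K: D0 \subset K.
  by rewrite -(quotientGK (normalS sX1K sKX nX1X)) morphpreS ?pcore_sub.
have nD0X: X \subset 'N(D0).
  rewrite (subset_trans _ (morphpre_norm _ _)) // -sub_quotient_pre //.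
  rewrite gFnorm_trans // quotient_norms ?normal_norm //.
have nKR: R \subset 'N(K).
  exact: subset_trans sRB (subset_trans sBX (normal_norm nKX)).
pose RK := [~: K, R]%G; have sRKK: RK \subset K by rewrite commg_subl.
have nRKX: X \subset 'N(RK).
  rewrite -trK mul_subG ?commg_norml // normsR //.
  by rewrite (subset_trans sBX) ?normal_norm.
have defK: (RK <*> D0)%G :=: K.
  apply: (comm_regular_full sRB) => //.
  - by rewrite /normal join_subG (subset_trans sRKK) ?(subset_trans sD0K) ?normsY.
  - by rewrite (subset_trans sX1D0) ?joing_subr.
  - by rewrite join_subG sRKK.
  exact: joing_subl.
have hallQ := nilpotent_pcore_Hall p^' nilK.
have nD0K := subset_trans sKX nD0X.
have nD0R := subset_trans sRB (subset_trans sBX nD0X).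
have pKD: p.-group (K / D0).
  have /and3P[_ _] := hallQ; rewrite pnatNK.
  rewrite /pgroup card_quotient // -index_cosetpre.
  by rewrite quotientGK ?(normalS sX1K sKX).
have KD1: K / D0 = 1.
  apply/eqP; apply: contraT => ntKD.
  have pKR: p.-group ((K / D0) <*> (R / D0)).
    rewrite norm_joinEr ?quotient_norms // pgroupM pKD.
    by rewrite quotient_pgroup ?pcore_pgroup.
  have: [~: K / D0, R / D0] \proper K / D0.
    rewrite (nil_comm_properl (pgroup_nil pKR)) ?joing_subl // subsetI.
    by rewrite joing_subr quotient_norms.
  have -> : [~: K / D0, R / D0] = K / D0.
    rewrite -quotientR // -[in RHS]defK quotientYidr //.
    exact: subset_trans sRKK nD0K.
  by rewrite properxx.
have sKD0: K \subset D0 by rewrite -quotient_sub1 // KD1.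
rewrite index_arc_stab -card_quotient //.
have sKQ: K / X1 \subset Q by rewrite -(cosetpreK Q) quotientS.
have [p_pr _ _] := pgroup_pdiv (pcore_pgroup p B) ntR.
by rewrite -p'natE //; apply: pgroupS sKQ (pcore_pgroup _ _).
Qed.

(** The subgroup [E] of [B] acting trivially on [K / D] contains [A] and is normalised by [B];
    outside [X1] it would force [D = K] by [comm_regular_full]. *)
Lemma comm_proper_sub_kernel A D :
    A \subset B -> D <| X -> X1 \subset D -> D \subset K -> D :!=: K ->
  [~: K, A] \subset D -> A \subset X1.
Proof.
move=> sAB nDX sX1D sDK neDK cKA; have nDX' := normal_norm nDX.
have nDB := subset_trans sBX nDX'; have nDK := subset_trans sKX nDX'.
pose E := (B :&: coset D @*^-1 'C(K / D))%G.
have cKE: [~: K, E] \subset D.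
  have nDE: E \subset 'N(D) := subset_trans (subsetIl B _) nDB.
  rewrite -quotient_cents2 // centsC sub_quotient_pre //; exact: subsetIr.
have nEB: B \subset 'N(E).
  rewrite normsI ?normG // norm_quotient_pre // norms_cent ?quotient_norms //.
  exact: subset_trans (normal_norm nKX).
have sAE: A \subset E.
  rewrite subsetI sAB -sub_quotient_pre ?(subset_trans sAB) // centsC.
  by rewrite quotient_cents2 ?(subset_trans sAB).
apply: subset_trans sAE _; apply: contraR neDK => nsEX1; apply/eqP.
exact: (comm_regular_full (subsetIl _ _) nEB).
Qed.

(** * Pushing up at a prime not dividing the valency *)

Section PushingUp.

Variables (p : nat) (S : {group gT}).
Hypotheses (p_pr : prime p) (d6 : coprime #|X : B| 6).
Hypothesis p'd : ~~ (p %| #|X : B|).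
Hypothesis sylS : p.-Sylow(B) S.

Let T := (X1 :&: S)%G.
Let M := 'N_X(T)%G.
Let V := ('Ohm_1('Z(T)))%G.
Let C := 'C_M(V)%G.

Let sSB : S \subset B := pHall_sub sylS.
Let pS : p.-group S := pHall_pgroup sylS.
Let sTS : T \subset S := subsetIr _ _.
Let sSX : S \subset X := subset_trans sSB sBX.
Let sMX : M \subset X := subsetIl _ _.
Let sylT : p.-Sylow(X1) T.
Proof. by apply: Sylow_setI_normal sylS; rewrite /normal sX1B. Qed.
Let pT : p.-group T := pHall_pgroup sylT.
Let nTS : S \subset 'N(T).
Proof. by rewrite normsI ?normG ?(subset_trans sSX). Qed.
Let sSM : S \subset M.
Proof. by rewrite subsetI sSX. Qed.
Let X1M : X1 * M = X.
Proof. exact: Frattini_arg nX1X sylT. Qed.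
Let sVZ : V \subset 'Z(T) := Ohm_sub 1 _.
Let sVT : V \subset T := subset_trans sVZ (center_sub T).
Let abelV : p.-abelem V.
Proof. by rewrite Ohm1_abelem ?center_abelian // (pgroupS (center_sub T)). Qed.
Let nVM : M \subset 'N(V).
Proof. by rewrite (subset_trans (subsetIr X _)) // !gFnorm_trans. Qed.
Let nCM : C <| M.
Proof. by rewrite /normal subsetIl normsI ?normG ?norms_cent. Qed.
Let nCX1X : (C <*> X1)%G <| X.
Proof.
have sCX: C \subset X := subset_trans (subsetIl M _) sMX.
have nCX1: X1 \subset 'N(C <*> X1) := subset_trans (joing_subr C X1) (normG _).
have nCM': M \subset 'N(C <*> X1).
  exact: normsY (normal_norm nCM) (subset_trans sMX nX1).
by rewrite /normal join_subG sCX (normal_sub nX1X) /= -{1}X1M mul_subG.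
Qed.

Lemma Sylow_swap : exists2 s, s \in B :* t & s \in 'N(S).
Proof.
have sylSt: p.-Sylow(B) (S :^ t^-1) by rewrite pHallJnorm ?groupV.
have [b Bb defSb] := Sylow_trans sylS sylSt.
exists (b * t); first by rewrite mem_rcoset mulgK.
by apply/normP; rewrite conjsgM -defSb conjsgKV.
Qed.

(** If [p] divides [#|N|], the normal subgroup [N :&: S] of [S] meets ['Z(S)], so [Z] is nontrivial.
    It lies in [V], which [C] centralises, and a swap normalising [S] normalises it. *)
Lemma Ohm1_cent_transitive : B * (C <*> X1) = X -> ~~ (p %| #|N|).
Proof.
move=> trCX1; apply/negP=> dvN; have [s Bts nSs] := Sylow_swap.
have trC: B * C = X.
  rewrite -trCX1 /= joingC norm_joinEr; last first.
    by rewrite (subset_trans (subset_trans (subsetIl M _) sMX)).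
  by rewrite mulgA (mulGSid sX1B).
have sylNS: p.-Sylow(N) (N :&: S) := Sylow_setI_normal edge_kernel_normal sylS.
have ntNS: N :&: S != 1.
  rewrite trivg_card1 (card_Hall sylNS) p_part_eq1 negbK.
  by rewrite mem_primes p_pr cardG_gt0.
have nNS: (N :&: S)%G <| S.
  rewrite /normal subsetIr normsI ?normG // (subset_trans sSB) //.
  exact: normal_norm edge_kernel_normal.
pose Z := (N :&: 'Ohm_1('Z(S)))%G.
have ntZ: Z :!=: 1.
  apply: contraNneq (meet_center_nil (pgroup_nil pS) nNS ntNS) => /TI_Ohm1 NZ1.
  by rewrite -subG1 -NZ1 setSI ?subsetIl.
have sZOS: Z \subset 'Ohm_1('Z(S)) := subsetIr _ _.
have sZZS: Z \subset 'Z(S) := subset_trans sZOS (Ohm_sub _ _).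
have abelZ: p.-abelem Z.
  apply: abelemS sZOS _; rewrite Ohm1_abelem ?center_abelian //.
  exact: pgroupS (center_sub S) pS.
have sZT: Z \subset T.
  rewrite subsetI (subset_trans sZZS (center_sub S)) andbT.
  exact: subset_trans (subsetIl _ _) (subsetIl _ _).
have sZV: Z \subset V.
  rewrite -(Ohm1_id abelZ) OhmS // subsetI sZT.
  by rewrite (subset_trans sZZS) // subIset // (centS sTS) orbT.
case/negP: ntZ; apply/eqP.
apply: (faithful _ (subset_trans (subsetIl M _) sMX) trC _ Bts).
- exact: subset_trans sZT (subset_trans sTS sSB).
- by rewrite cents_norm // centsC (subset_trans sZV) // centsC subsetIr.
rewrite inE /= conjIg (normP (swap_norm Bts)) setIS //.
rewrite (normP (_ : s \in 'N(_))) //.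
exact: subsetP (gFnorm_trans _ (gFnorm_trans _ (subxx _))) s nSs.
Qed.

(** As [C <*> X1] is not transitive, [D] is proper in [K], and it suffices that [A] centralises
    [K / D]. Modulo [C], the offender [A] centralises a subgroup [Q] of {2,3}-index in [H]; since
    [H] covers [K / D], of order prime to 6, so does [Q]. *)
Lemma pnElem_sub_vertex_kernel A :
    ~ (B * (C <*> X1) = X) -> A \in 'E_p^('r_p(S))(S) -> A \subset X1.
Proof.
move=> ntrC EA; have [sAS abelA _] := pnElemP EA.
have sAB := subset_trans sAS sSB; have sAM := subset_trans sAS sSM.
pose D := (K :&: (C <*> X1))%G.
have nDX: D <| X by rewrite normalI.
have sX1D: X1 \subset D by rewrite subsetI sX1K joing_subr.
have sDK: D \subset K := subsetIl _ _.
apply: (comm_proper_sub_kernel sAB nDX sX1D sDK).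
  apply: contra_notN ntrC => /eqP defK; apply/eqP.
  rewrite eqEsubset mul_subG ?(normal_sub nCX1X) //= -{1}trK mulgS //.
  exact/setIidPl.
pose H := (K :&: M)%G; have sHM: H \subset M := subsetIr _ _.
have nHA: A \subset 'N(H).
  rewrite normsI ?(subset_trans sAM (normG M)) //.
  by rewrite (subset_trans (subset_trans sAM sMX)) ?normal_norm.
have sTH: T \subset H.
  by rewrite subsetI (subset_trans _ sX1K) ?subsetIl // (subset_trans sTS).
(* [T] centralises [V] and has index prime to [p] in [K]: [#|K : X1|] is the valency and [T] is
   Sylow in [X1]. *)
have p'H: p^'.-group (conj_aut V @* H).
  rewrite /pgroup card_morphim (setIidPr (subset_trans sHM nVM)) ker_conj_aut.
  have sTC: T \subset 'C(V) by rewrite centsC (subset_trans sVZ) ?subsetIr.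
  apply: pnat_dvd (indexgS H sTC) (pnat_dvd (indexSg sTH (subsetIl _ _)) _).
  rewrite -(Lagrange_index sX1K (subsetIl X1 S)) pnatM.
  by rewrite -index_arc_stab p'natE // p'd; case/and3P: sylT.
have best Y : Y \subset A -> #|Y| * #|'C_V(Y)| <= #|A| * #|'C_V(A)|.
  exact: (max_pnElem_offender p_pr pS (subset_trans sVT sTS) abelV EA).
have [Q [sQH cQA iQ]] :=
  offender_cent_index abelV abelA (subset_trans sAM nVM)
    (subset_trans sHM nVM) nHA p'H best.
have nDK: K \subset 'N(D) := subset_trans sKX (normal_norm nDX).
have defK: X1 * H = K by rewrite /= setIC group_modl // X1M; apply/setIidPr.
have sHK: H \subset K := subsetIl _ _.
have defDH: D * H = K.
  by apply/eqP; rewrite eqEsubset mul_subG //= -{1}defK mulSg.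
have defKD: K / D = H / D by rewrite -(quotientMidl D H) defDH.
have defKQ: K / D = Q / D.
  apply/eqP; rewrite eqEsubset (quotientS D (subset_trans sQH sHK)) andbT.
  rewrite -indexg_eq1; apply/eqP/(@pnat_1 (pred2 2 3)).
    rewrite /= defKD; apply: pnat_dvd iQ; apply: index_morphim.
    by rewrite subIset // (subset_trans sHK).
  apply: (pnat_dvd (dvdn_indexg _ _)); rewrite /= card_quotient //.
  apply: (pnat_dvd (indexgS K sX1D)); rewrite -index_arc_stab.
  apply/pnatP=> // r r_pr dvr; rewrite !inE; apply/norP.
  by split; apply: contraTneq d6 => r23; rewrite /coprime gtn_eqF //;
     apply: leq_trans (prime_gt1 r_pr) _; apply: dvdn_leq;
     rewrite ?gcdn_gt0 ?orbT // dvdn_gcd dvr r23.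
rewrite -quotient_cents2 ?(subset_trans sAB) //; last first.
  exact: subset_trans sBX (normal_norm nDX).
rewrite defKQ quotient_cents2 //; last 2 first.
- exact: subset_trans (subset_trans sQH sHK) nDK.
- exact: subset_trans sAB (subset_trans sBX (normal_norm nDX)).
have sQAH: [~: Q, A] \subset H.
  by rewrite (subset_trans (commSg _ sQH)) // commg_subl.
rewrite subsetI (subset_trans sQAH sHK) (subset_trans _ (joing_subl _ _)) //.
by rewrite subsetI (subset_trans sQAH sHM).
Qed.

Lemma Sylow_edge_kernel : ~~ (p %| #|N|).
Proof.
have [/eqP | /eqP ntrC] := boolP (B * (C <*> X1) == X :> {set gT}).
  exact: Ohm1_cent_transitive.
apply/negP=> dvN; have [s Bts nSs] := Sylow_swap.
have sETp: {in 'E_p^('r_p(S))(S), forall A : {group gT}, A \subset T}.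
  move=> A EA; rewrite subsetI (pnElem_sub_vertex_kernel ntrC EA).
  by case/pnElemP: EA.
have dvS: p %| #|S|.
  rewrite (card_Hall sylS) -{1}(part_pnat_id (pnat_id p_pr)) partn_dvd //.
  exact: dvdn_trans dvN (cardSg (normal_sub edge_kernel_normal)).
case/negP: (thompson_subgroup_neq1 p_pr dvS); apply/eqP.
apply: (faithful (Y := thompson_group p S) _ sMX _ _ Bts).
- exact: subset_trans (thompson_subgroup_sub p S) sSB.
- by rewrite -(mulGSid sX1B) -mulgA X1M mulSGid.
- exact: subset_trans (subsetIr X _) (thompson_subgroup_norm_sub sETp sTS).
exact: subsetP (thompson_subgroup_norm p S) s nSs.
Qed.

End PushingUp.

Lemma edge_kernel_p' p : prime p -> coprime #|X : B| 6 ->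
  ~~ (p %| #|X : B|) -> ~~ (p %| #|N|).
Proof.
move=> p_pr d6 p'd; have [S sylS] := Sylow_exists p B.
exact: Sylow_edge_kernel sylS.
Qed.

Theorem edge_kernel_trivial : coprime #|X : B| 6 -> N :=: 1.
Proof.
move=> d6; apply/eqP; apply: contraT => ntN.
have [[p ntO] | /negP[]] := pcore_or_semisimple_core ntN; last first.
  exact/eqP/semisimple_core_edge_kernel.
have [p_pr dvO _] := pgroup_pdiv (pcore_pgroup p N) ntO.
have pB: 'O_p(B) != 1.
  apply: contraNneq ntO => O1; rewrite -subG1 -O1 pcore_max ?pcore_pgroup //.
  exact: char_normal_trans (pcore_char _ _) edge_kernel_normal.
case/negP: (edge_kernel_p' p_pr d6 (pcore_ndvd_index pB)).
exact: dvdn_trans dvO (cardSg (pcore_sub _ _)).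
Qed.

End Amalgam.

(** * Graphs *)

Section LocalAmalgam.

Variables (T : finType) (e : rel T) (G : {group {perm T}}) (x y : T).
Hypotheses (sym_e : symmetric e) (e_conn : connected_graph e).
Hypotheses (sGA : G \subset graph_aut e) (G_arc : arc_transitive e G).
Hypothesis exy : e x y.
Hypothesis Lsemi : semiprimitive (neighbours e x) (local_action e G x).
Variable R : {group {perm T}}.
Hypotheses (nRL : R <| local_action e G x) (nilR : nilpotent R).
Hypothesis regR : perm_regular (neighbours e x) R.
Variable t : {perm T}.
Hypotheses (Gt : t \in G) (tx : t x = y) (ty : t y = x).

Local Notation f := (restr_perm (neighbours e x)).

Let X := 'C_G[x | 'P]%G.
Let B := 'C_X[y | 'P]%G.
Let X1 := 'C_X(neighbours e x | 'P)%G.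
Let K := (X :&: f @*^-1 R)%G.

Lemma mem_vertex_stab z g : reflect (g \in G /\ g z = z) (g \in 'C_G[z | 'P]).
Proof.
by apply: (iffP setIP) => [[Gg /astab1P] | [Gg gz]]; split=> //; apply/astab1P.
Qed.

Lemma mem_arc_stab g : reflect (g \in X /\ g y = y) (g \in B).
Proof.
by apply: (iffP setIP) => [[Xg /astab1P] | [Xg gy]]; split=> //; apply/astab1P.
Qed.

Lemma mem_vertex_kernel g :
  reflect (g \in X /\ forall z, e x z -> g z = z) (g \in X1).
Proof.
apply: (iffP setIP) => [[Xg /astabP fixg] | [Xg fixg]]; split=> //.
  by move=> z exz; apply: fixg; rewrite inE.
by apply/astabP=> z; rewrite inE; apply: fixg.
Qed.

Lemma graph_autE g u v : g \in G -> e (g u) (g v) = e u v.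
Proof. by move=> /(subsetP sGA)/graph_autP. Qed.

Let sXN : X \subset 'N(neighbours e x | 'P) := stab_neighbours x sGA.

Lemma restr_nbhdE g z : g \in X -> e x z -> f g z = g z.
Proof.
by move=> Xg exz; apply: (restr_permE (subsetP sXN g Xg)); rewrite inE.
Qed.

Lemma vertex_kernelE : X1 :=: 'ker_X f.
Proof. by rewrite /= ker_restr_perm. Qed.

Lemma restr_eq1 g : g \in X -> f g = 1 -> g \in X1.
Proof.
move=> Xg fg1; rewrite vertex_kernelE inE Xg.
by apply/kerP; first exact: subsetP sXN g Xg.
Qed.

Lemma local_transitive z : e x z -> exists2 g, g \in X & g y = z.
Proof.
move=> exz; have [g Gg [gx gy]] := G_arc exy exz.
by exists g => //; apply/mem_vertex_stab.
Qed.

Lemma transitive_factor (W : {group {perm T}}) :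
  W \subset X -> [transitive f @* W, on neighbours e x | 'P] -> B * W = X.
Proof.
move=> sWX trW; apply/eqP; rewrite eqEsubset mul_subG ?subsetIl //=.
apply/subsetP=> g Xg; have [Gg gx] := mem_vertex_stab _ _ Xg.
have exgy: e x (g y) by rewrite -gx graph_autE.
have [||_ /morphimP[w Nw Ww ->] /= fwy] :=
  atransP2 trW (_ : y \in _) (_ : g y \in _).
- by rewrite inE.
- by rewrite inE.
have Xw := subsetP sWX w Ww.
apply/mulsgP; exists (g * w^-1) w; rewrite ?mulgKV //.
apply/mem_arc_stab; rewrite groupM ?groupV //; split=> //.
by rewrite permM fwy /aperm restr_nbhdE // permK.
Qed.

Lemma semiregular_stab (W : {group {perm T}}) :
  W \subset X -> perm_semiregular (neighbours e x) (f @* W) ->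
  W :&: B \subset X1.
Proof.
move=> sWX srW; apply/subsetP=> g /setIP[Wg /mem_arc_stab[Xg gy]].
have: f g \in 'C_(f @* W)[y | 'P].
  rewrite inE mem_morphim ?(subsetP sXN) //=; apply/astab1P.
  by rewrite /= /aperm restr_nbhdE.
rewrite srW; last by rewrite inE.
by move/set1P; apply: restr_eq1.
Qed.

(** ['N_G(Y)] contains [U], transitive on the neighbours of [x], and an element taking [x] to [y];
    by connectedness it is transitive on vertices. Since [Y] fixes [x], it fixes every vertex. *)
Lemma local_faithful (Y U : {group {perm T}}) s :
  Y \subset B -> U \subset X -> B * U = X -> U \subset 'N(Y) ->
  s \in B :* t -> s \in 'N(Y) -> Y \subset [1].
Proof.
move=> sYB sUX trU nYU /rcosetP[b /mem_arc_stab[Xb bY] ->] nYs.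
have [Gb bx] := mem_vertex_stab _ _ Xb.
pose F := 'N_G(Y)%G.
have Fs: b * t \in F by rewrite inE nYs groupM.
have sUF: U \subset F.
  by rewrite subsetI nYU (subset_trans sUX) ?subsetIl.
have step u v h : h \in F -> h x = u -> e u v -> exists2 k, k \in F & k x = v.
  move=> Fh <- ehv; have [Gh _] := setIP Fh.
  have exz: e x (h^-1 v) by rewrite -(graph_autE _ _ Gh) permKV.
  have [g Xg gy] := local_transitive exz.
  move: Xg; rewrite -{1}trU => /mulsgP[c w /mem_arc_stab[_ cy] Uw defg].
  (* Factors act from left to right: [b * t] takes [x] to [y], [w] takes [y] to [h^-1 v], and [h]
     takes that to [v]. *)
  exists (b * t * w * h); first exact: groupM (groupM Fs (subsetP sUF w Uw)) Fh.
  by rewrite !permM bx tx -(permKV h v) -gy defg permM cy.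
have reach p u h : h \in F -> h x = u -> path e u p ->
    exists2 k, k \in F & k x = last u p.
  elim: p u h => [|w p IHp] u h Fh hu /=; first by exists h.
  by case/andP=> /(step _ _ h Fh hu)[k Fk kx]; apply: IHp Fk kx.
apply/subsetP=> a Ya; apply/set1P/permP=> v; rewrite perm1.
have [p ep ->] := connectP (e_conn x v).
have [h /setIP[Gh nYh] <-] := reach p x 1 (group1 _) (perm1 x) ep.
have: a ^ h^-1 \in B by rewrite (subsetP sYB) // memJ_norm ?groupV.
case/mem_arc_stab=> /mem_vertex_stab[_ fixa] _.
by rewrite -[in RHS]fixa conjgE invgK !permM permKV.
Qed.

Lemma local_edge_kernel_trivial :
  coprime #|neighbours e x| 6 -> X1 :&: X1 :^ t = 1.
Proof.
have sBX: B \subset X := subsetIl _ _.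
have nX1X: X1 <| X.
  by rewrite vertex_kernelE; apply: normalGI sXN (ker_normal _).
have sX1B: X1 \subset B.
  apply/subsetP=> g /mem_vertex_kernel[Xg fixg].
  by apply/mem_arc_stab; rewrite fixg.
have nBt: t \in 'N(B).
  rewrite -groupV inE; apply/subsetP=> _ /imsetP[g /mem_arc_stab[Xg gy] ->].
  have [Gg gx] := mem_vertex_stab _ _ Xg.
  apply/mem_arc_stab; split.
    apply/mem_vertex_stab; rewrite groupJ ?groupV //; split=> //.
    by rewrite conjgE invgK !permM tx gy -tx permK.
  by rewrite conjgE invgK !permM ty gx -ty permK.
have Bt2: t * t \in B.
  apply/mem_arc_stab; rewrite !permM ty tx; split=> //.
  by apply/mem_vertex_stab; rewrite groupM // !permM tx ty.
have nKX: K <| X.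
  apply: (@normalGI _ (f @*^-1 (f @* X))); first by rewrite -sub_morphim_pre.
  have sfX: f @* X \subset f @* 'N(neighbours e x | 'P) := morphimS _ sXN.
  by rewrite morphpre_normal ?(subset_trans (normal_sub nRL)).
have fK: f @* K = R.
  rewrite /= morphim_setIpre; apply/setIidPr; exact: normal_sub nRL.
have sX1K: X1 \subset K.
  by rewrite vertex_kernelE subsetI subsetIl subIset // ker_sub_pre orbT.
have sKX: K \subset X := normal_sub nKX.
have tiKB: K :&: B = X1.
  apply/eqP; rewrite eqEsubset subsetI sX1K sX1B !andbT.
  apply: semiregular_stab => // w nbw; rewrite /= fK.
  by case: regR => _; apply.
have trK: B * K = X by apply: transitive_factor; rewrite // fK; case: regR.
have nilK: nilpotent (K / X1).
  have ->: X1 :=: 'ker_K f.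
    apply/eqP; rewrite eqEsubset subsetI sX1K vertex_kernelE subsetIr setSI //.
  have sKN := subset_trans sKX sXN.
  have := first_isog_loc (restr_perm_morphism (neighbours e x)) sKN.
  by rewrite /= fK => /isog_nil->.
have iXB: #|X : B| = #|neighbours e x|.
  rewrite -card_orbit; apply: eq_card => z; rewrite inE.
  apply/orbitP/idP=> [[g Xg <-] | /local_transitive[g Xg gy]]; last by exists g.
  by have [Gg gx] := mem_vertex_stab _ _ Xg; rewrite /= /aperm -gx graph_autE.
rewrite -iXB => d6.
apply: (@edge_kernel_trivial _ X B X1 K t) => //.
- move=> Y U s sYB sUX trU nYU Bts nYs; apply/trivgP.
  exact: local_faithful sYB sUX trU nYU Bts nYs.
move=> W nWX; have sWX := normal_sub nWX.
have [|trW | srW] := (Lsemi.2 (f @* W)%G); first exact: morphim_normal.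
  by left; apply: transitive_factor.
by right; apply: semiregular_stab.
Qed.

Lemma vertex_stab_order :
  X1 :&: X1 :^ t = 1 -> #|X| <= #|neighbours e x|`! * (#|neighbours e y|.-1)`!.
Proof.
move=> N1; rewrite -(Lagrange (subsetIl X _ : X1 \subset X)) mulnC leq_mul //.
  have ->: #|X : X1| = #|f @* X|.
    by rewrite card_morphim (setIidPr sXN) vertex_kernelE indexgI.
  rewrite -card_perm subset_leq_card //; apply/subsetP=> _ /morphimP[g _ _ ->].
  exact: restr_perm_on.
pose S := neighbours e y :\ x.
have nyx: x \in neighbours e y by rewrite inE sym_e.
have ->: #|neighbours e y|.-1 = #|S| by rewrite (cardsD1 x) nyx.
have X1E g : g \in X1 -> [/\ g \in G, g x = x & g y = y].
  case/mem_vertex_kernel=> /mem_vertex_stab[Gg gx] fixg.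
  by split=> //; apply: fixg.
have nSX1: X1 \subset 'N(S | 'P).
  apply/subsetP=> g /X1E[Gg gx gy]; rewrite !inE; apply/subsetP=> z.
  by rewrite !inE /= /aperm -{2}gx (inj_eq perm_inj) -{2}gy graph_autE.
(* An element of [X1] fixing [S] pointwise fixes all neighbours of [y = t x], so it lies in
   [X1 :^ t]. *)
have tiS: X1 :&: 'ker (restr_perm S) = 1.
  rewrite ker_restr_perm; apply/trivgP; rewrite -N1 subsetI subsetIl.
  apply/subsetP=> g /setIP[X1g /astabP fixS]; have [Gg gx gy] := X1E g X1g.
  rewrite mem_conjg; apply/mem_vertex_kernel; rewrite conjgE invgK; split.
    apply/mem_vertex_stab; rewrite !groupM ?groupV //; split=> //.
    by rewrite !permM tx gy -tx permK.
  move=> z exz; rewrite !permM; apply: (canLR (permK t)).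
  have [-> // | neq_tzx] := eqVneq (t z) x.
  by apply: fixS; rewrite !inE neq_tzx -tx graph_autE.
rewrite -card_perm -[X in X <= _](indexg1 X1) -tiS indexgI.
rewrite -[X in #|X : _|](setIidPr nSX1) -card_morphim subset_leq_card //.
by apply/subsetP=> _ /morphimP[g _ _ ->]; apply: restr_perm_on.
Qed.

End LocalAmalgam.

Theorem theorem1p1 (T : finType) (e : rel T) (d : nat) (G : {group {perm T}})
    (e_simple : simple_graph e) (e_connected : connected_graph e)
    (e_valency : has_valency e d)
    (sGA : G \subset graph_aut e) (G_arc : arc_transitive e G)
    (G_semiprim : forall x : T,
       semiprimitive (neighbours e x) (local_action e G x))
    (G_nilreg : forall x : T, exists N : {group {perm T}},
       [/\ (N <| local_action e G x)%g, nilpotent N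
         & perm_regular (neighbours e x) N])
    (d_coprime6 : gcdn d 6 = 1%N) :
  forall x : T, (#|('C_G[x | 'P])%g| <= d`! * (d.-1)`!)%N.
Proof.
move=> x; have [sym_e _] := e_simple.
(* [gcdn 0 6] is 6, so the valency is positive. *)
have d_gt0: (0 < d)%N by case: (d) d_coprime6.
have [y exy]: exists y, e x y.
  move: d_gt0; rewrite -(e_valency x) => /card_gt0P[y].
  by rewrite inE; exists y.
have [R [nRL nilR regR]] := G_nilreg x.
have [t Gt [tx ty]] := G_arc x y y x exy (etrans (sym_e y x) exy).
have d6: coprime #|neighbours e x| 6 by rewrite e_valency /coprime d_coprime6.
rewrite -{1}(e_valency x) -(e_valency y).
apply: (vertex_stab_order sym_e sGA exy Gt tx).
exact: (local_edge_kernel_trivial e_connected sGA G_arc exy (G_semiprim x)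
  nRL nilR regR Gt tx ty d6).
Qed.
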